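(* For every $n\in\mathbb{N}$, the norm in $\mathrm{FBfA}[\ell_1^n]$ is $\tau$; that is, $\|f\|=\tau_{\ell_1^n}(f)$ for every $f\in\mathrm{FBfA}[\ell_1^n]$.
   Context: All spaces are real. A vector lattice algebra is a real associative algebra that is also a vector lattice in which the product of positive elements is positive. An $f$-algebra is a vector lattice algebra such that $a\wedge b=0$ and $c\ge 0$ imply $(ac)\wedge b=0=(ca)\wedge b$. A Banach $f$-algebra is an $f$-algebra equipped with a complete, submultiplicative lattice norm. It is semiprime if $a^2=0$ implies $a=0$. A lattice-algebra homomorphism is a linear map preserving the lattice operations and the product. Contractive means of operator norm at most $1$. The free Banach $f$-algebra generated by a Banach space $E$ is a Banach $f$-algebra $\mathrm{FBfA}[E]$ together with a linear isometric embedding $\eta_E\colon E\to\mathrm{FBfA}[E]$ such that for every Banach $f$-algebra $A$ and every contractive operator $T\colon E\to A$ there exists a unique lattice-algebra homomorphism $\hat T\colon\mathrm{FBfA}[E]\to A$ satisfying $\hat T\circ\eta_E=T$ and $\|\hat T\|=\|T\|$. It exists and is unique up to isometric lattice-algebra isomorphism. For $f\in\mathrm{FBfA}[E]$, $\tau_E(f)$ (or $\tau(f)$) is the least non-negative number such that $\|\hat Tf\|\le\tau_E(f)$ for every semiprime finite-dimensional Banach $f$-algebra $A$ and every contractive operator $T\colon E\to A$. $\ell_1^n$ is $\mathbb{R}^n$ with the norm $\sum_i|x_i|$. *)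

(* Defs.v *)
From HB Require Import structures.
From mathcomp Require Import all_boot all_order all_algebra.
From mathcomp Require Import all_classical all_reals all_analysis.

Set Implicit Arguments.
Unset Strict Implicit.
Unset Printing Implicit Defensive.

Import Order.TTheory GRing.Theory Num.Theory.
Import numFieldNormedType.Exports.

Local Open Scope classical_set_scope.
Local Open Scope ring_scope.

(* The order is a field of the mixin because MathComp's order structures cannot
   be joined with normed modules outside the [numDomainType] hierarchy. *)
HB.mixin Record Lmodule_isVectorLattice (R : realType) V
    of GRing.Lmodule R V := {
  vle : rel V ;
  vjoin : V -> V -> V ;
  vmeet : V -> V -> V ;
  vle_refl : reflexive vle ;
  vle_anti : antisymmetric vle ;
  vle_trans : transitive vle ;
  vle_joinl : forall x y z : V, vle (vjoin x y) z = vle x z && vle y z ;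
  vle_meetr : forall x y z : V, vle z (vmeet x y) = vle z x && vle z y ;
  vle_add2r : forall x y z : V, vle x y -> vle (x + z) (y + z) ;
  vle_scale_ge0 : forall (a : R) (x : V), 0 <= a -> vle 0 x -> vle 0 (a *: x)
}.

#[short(type="vectorLatticeType")]
HB.structure Definition VectorLattice (R : realType) :=
  { V of GRing.Lmodule R V & Lmodule_isVectorLattice R V }.

Notation "x <=v y" := (vle x y) (at level 70, y at next level) : ring_scope.
Notation "x `\/` y" := (vjoin x y)
  (at level 52, left associativity) : ring_scope.
Notation "x `/\` y" := (vmeet x y)
  (at level 48, left associativity) : ring_scope.

(* Algebras need not have a unit, so the product is not the product of a
   MathComp ring: it is the (associative) operation [( x * y )%g] of a
   [semigroupType]. *)
HB.mixin Record VectorLattice_isVectorLatticeAlgebra (R : realType) V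
    of VectorLattice R V & Semigroup V := {
  vla_mulDl : forall x y z : V, ((x + y)%R * z)%g = (x * z)%g + (y * z)%g ;
  vla_mulDr : forall x y z : V, (x * (y + z)%R)%g = (x * y)%g + (x * z)%g ;
  vla_scaleAl : forall (a : R) (x y : V), ((a *: x)%R * y)%g = a *: (x * y)%g ;
  vla_scaleAr : forall (a : R) (x y : V), (x * (a *: y)%R)%g = a *: (x * y)%g ;
  vla_mul_ge0 : forall x y : V, 0 <=v x -> 0 <=v y -> 0 <=v (x * y)%g
}.

#[short(type="vectorLatticeAlgType")]
HB.structure Definition VectorLatticeAlgebra (R : realType) :=
  { V of VectorLattice R V & Semigroup V
       & VectorLattice_isVectorLatticeAlgebra R V }.

HB.mixin Record VectorLatticeAlgebra_isFAlgebra (R : realType) V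
    of VectorLatticeAlgebra R V := {
  falg_mulr_disj : forall a b c : V,
    a `/\` b = 0 -> 0 <=v c -> (a * c)%g `/\` b = 0 ;
  falg_mull_disj : forall a b c : V,
    a `/\` b = 0 -> 0 <=v c -> (c * a)%g `/\` b = 0
}.

#[short(type="fAlgType")]
HB.structure Definition FAlgebra (R : realType) :=
  { V of VectorLatticeAlgebra R V & VectorLatticeAlgebra_isFAlgebra R V }.

(* The modulus of the lattice; [`|x|] is the norm. *)
Definition vabs (R : realType) (V : vectorLatticeType R) (x : V) : V :=
  x `\/` (- x).

HB.mixin Record FAlgebra_isBanachFAlgebra (R : realType) V
    of FAlgebra R V & CompleteNormedModule R V := {
  bfalg_lattice_norm : forall x y : V, vabs x <=v vabs y -> `|x| <= `|y| ;
  bfalg_normM : forall x y : V, `|(x * y)%g| <= `|x| * `|y|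
}.

#[short(type="banachFAlgType")]
HB.structure Definition BanachFAlgebra (R : realType) :=
  { V of FAlgebra R V & CompleteNormedModule R V
       & FAlgebra_isBanachFAlgebra R V }.

Definition semiprime (R : realType) (A : fAlgType R) : Prop :=
  forall a : A, (a * a)%g = 0 -> a = 0.

Definition finite_dimensional (R : realType) (V : lmodType R) : Prop :=
  exists (m : nat) (b : 'I_m -> V),
    forall x : V, exists c : 'I_m -> R, x = \sum_(i < m) c i *: b i.

Definition lattice_algebra_hom (R : realType) (A B : vectorLatticeAlgType R)
    (S : {linear A -> B}) : Prop :=
  [/\ forall x y, S (x `\/` y) = S x `\/` S y,
      forall x y, S (x `/\` y) = S x `/\` S y
    & forall x y, S (x * y)%g = (S x * S y)%g].

Definition opnorm (R : realType) (V W : normedModType R)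
    (T : {linear V -> W}) : \bar R :=
  ereal_sup [set `|T x|%:E | x in [set x : V | `|x| <= 1]].

Definition contractive (R : realType) (V W : normedModType R)
    (T : {linear V -> W}) : Prop := (opnorm T <= 1)%E.

Section FreeBanachFAlgebra.
Context {R : realType} {E : completeNormedModType R} {F : banachFAlgType R}.
Variable eta : {linear E -> F}.

Definition is_extension (A : banachFAlgType R)
    (T : {linear E -> A}) (S : {linear F -> A}) : Prop :=
  lattice_algebra_hom S /\ forall x, S (eta x) = T x.

(* Uniqueness is among all lattice-algebra homomorphisms extending [T]; asking
   it only of those with the norm of [T] makes no difference if [E != 0], but
   would not determine [F] if [E = 0]. *)
Definition is_FBfA : Prop :=
  (forall x, `|eta x| = `|x|) /\
  forall (A : banachFAlgType R) (T : {linear E -> A}), contractive T ->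
    exists S : {linear F -> A},
      [/\ is_extension T S, opnorm S = opnorm T
        & forall S' : {linear F -> A}, is_extension T S' -> S' =1 S].

Definition tau_bounds (f : F) : set R :=
  [set t | 0 <= t /\
    forall A : banachFAlgType R, semiprime A -> finite_dimensional A ->
    forall T : {linear E -> A}, contractive T ->
    forall S : {linear F -> A}, is_extension T S -> `|S f| <= t].

Definition tau (f : F) : R := inf (tau_bounds f).

End FreeBanachFAlgebra.

Lemma opnorm_le (R : realType) (V W : normedModType R)
    (T : {linear V -> W}) (x : V) : (opnorm T <= 1)%E -> `|T x| <= `|x|.
Proof.
move=> T1; have [->|x0] := eqVneq x 0; first by rewrite linear0 !normr0.
have nx : 0 < `|x| by rewrite normr_gt0.
have : (`|T (`|x|^-1 *: x)|%:E <= 1)%E.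
  apply: le_trans T1; apply: ereal_sup_ubound; exists (`|x|^-1 *: x) => //=.
  by rewrite normrZ normfV normr_id mulVf// gt_eqF.
rewrite lee_fin linearZ normrZ normfV normr_id.
by rewrite ler_pdivrMl// mulr1.
Qed.

Lemma tau_least (R : realType) (E : completeNormedModType R)
    (F : banachFAlgType R) (eta : {linear E -> F}) (f : F) :
  is_FBfA eta ->
  tau_bounds eta f (tau eta f) /\
  forall t, tau_bounds eta f t -> tau eta f <= t.
Proof.
move=> [_ univ].
have lb0 : lbound (tau_bounds eta f) 0 by move=> t [].
have ne : tau_bounds eta f !=set0.
  exists `|f|; split=> // A _ _ T cT S eS.
  have [S0 [_ nS0 uS0]] := univ A T cT.
  by rewrite (uS0 _ eS); apply: opnorm_le; rewrite nS0.
split; last by move=> t bt; apply: ge_inf => //; exists 0.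
split; first exact: lb_le_inf.
move=> A sA dA T cT S eS; apply: lb_le_inf => // t [_ bt].
exact: (bt A sA dA T cT S eS).
Qed.

Definition ell1 (R : realType) (n : nat) : Type := 'rV[R]_n.

HB.instance Definition _ (R : realType) (n : nat) :=
  GRing.Lmodule.copy (ell1 R n) 'rV[R]_n.

Section ell1_norm.
Variables (R : realType) (n : nat).
Implicit Types x y : ell1 R n.

Definition ell1_norm x : R := \sum_(i < n) `|x ord0 i|.

Lemma ell1_normD x y : ell1_norm (x + y) <= ell1_norm x + ell1_norm y.
Proof.
by rewrite -big_split; apply: ler_sum => i _; rewrite mxE ler_normD.
Qed.

Lemma ell1_normZ (a : R) x : ell1_norm (a *: x) = `|a| * ell1_norm x.
Proof. by rewrite mulr_sumr; apply: eq_bigr => i _; rewrite mxE normrM. Qed.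

Lemma ell1_norm0_eq0 x : ell1_norm x = 0 -> x = 0.
Proof.
move=> /eqP; rewrite psumr_eq0// => /allP x0; apply/rowP => i; rewrite !mxE.
by apply/eqP; rewrite -normr_eq0; apply: x0; rewrite mem_index_enum.
Qed.

HB.instance Definition _ := Lmodule_isNormed.Build R (ell1 R n)
  ell1_normD ell1_normZ ell1_norm0_eq0.

Lemma ell1_coord_le x i : `|x ord0 i| <= `|x|.
Proof. by rewrite [leRHS](bigD1 i)//= lerDl sumr_ge0. Qed.

Lemma ell1_complete (G : set_system (ell1 R n)) :
  ProperFilter G -> cauchy G -> cvg G.
Proof.
move=> GG /cauchy_ballP Gc.
have cG i : cvg ((fun x : ell1 R n => x ord0 i : R) @ G).
  apply: R_complete; apply/cauchy_ballP => e e0.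
  rewrite near_map2; apply: filterS (Gc e e0) => -[x y] /=.
  rewrite -!ball_normE /= => xy; apply: le_lt_trans xy.
  by have := ell1_coord_le (x - y) i; rewrite !mxE.
pose l : ell1 R n := \row_i lim ((fun x : ell1 R n => x ord0 i : R) @ G).
apply/cvg_ex; exists l; apply/cvgrPdist_le => /= e e0.
have e0' : 0 < e / n.+1%:R by rewrite divr_gt0.
have H : G [set x : ell1 R n |
    forall i, `|l ord0 i - x ord0 i| <= e / n.+1%:R].
  apply: filter_forall => i; have /cvgrPdist_le := cG i.
  by move=> /(_ _ e0'); rewrite mxE.
near=> x.
have xi : forall i, `|l ord0 i - x ord0 i| <= e / n.+1%:R by near: x.
apply: (@le_trans _ _ (\sum_(i < n) e / n.+1%:R)).
  by apply: ler_sum => i _; have := xi i; rewrite !mxE.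
rewrite sumr_const card_ord -[_ *+ n]mulr_natr -mulrA ger_pMr//.
by rewrite mulrC ler_pdivrMr// mul1r ler_nat.
Unshelve. all: by end_near. Qed.

HB.instance Definition _ := Uniform_isComplete.Build (ell1 R n) ell1_complete.

End ell1_norm.

(* Main.v *)
Require Import Defs.
From HB Require Import structures.
From mathcomp Require Import all_boot all_order all_algebra.
From mathcomp Require Import all_classical all_reals all_analysis.
From mathcomp Require Import lra ring.

Set Implicit Arguments.
Unset Strict Implicit.
Unset Printing Implicit Defensive.

Import Order.TTheory GRing.Theory Num.Theory.
Import numFieldNormedType.Exports.

(** Let x_1, ..., x_n in [F] be the images of the unit vectors and let [e] be
    the supremum of their moduli; then [e * e <= e]. Locally, that is on a small
    enough band, every x_i is nearly a multiple lam_i [e] with |lam_i| <= 1, and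
    [e * e] is nearly [c *: e] with 0 < c <= 1. There a lattice-algebraic
    expression f in the x_i is nearly s(f) [e], where s is the lattice
    homomorphism from [F] to the scalars with s(x_i) = lam_i and
    s(f g) = c s(f) s(g). So an element of [F] looks like a function f/e of the
    parameters (c, lam), and it can be sampled at finitely many of them.

    For a fine grid of parameters, the vectors indexed by the grid form a
    semiprime algebra for the product w_j t_j s_j, where w_j is the value of c
    at j ([walg]). Its norm is borrowed from [F]: the norm of t is the infimum
    of the norms of the positive g in [F] that lie above |t_j| [e] on the cell
    of every j ([grid_norm]; it is the maximum of this infimum and of the |t_j|,
    to be definite). It is submultiplicative because products of dominating
    elements dominate products ([grid_normM]), and x_i itself shows that the vector
    (lam_i) has norm at most 1. The universal property thus gives a homomorphism
    S from [F] to this algebra. Since the cells cover everything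
    ([grid_cell_cover]), an element g that dominates S f satisfies
    |f| <= g + 2 r [e] with r small ([approximable_dominated]). So the norm of f
    exceeds that of S f, hence tau f, by arbitrarily little at most. Conversely
    tau f is at most the norm of f, since extensions of contractive operators are
    contractive ([tau_le_norm]).

    [F] need not be Dedekind complete, so band projections to localize with may
    not exist; inequalities modulo the band of elements disjoint from a fixed
    u >= 0 ([vlemod]) replace them. They are compatible with all the operations of an
    f-algebra, which makes the elements that are nearly s(f) [e] on small cells
    ([approximable]) a sublattice and a subalgebra. This set is also norm
    closed, as the modulus of a member is at most its norm times [e]
    ([approximable_le]), hence it is all of [F] by uniqueness in the universal
    property ([FBfA_generated]). *)

Local Open Scope ring_scope.

(** * Vector lattices *)
Section VectorLatticeTheory.
Variables (R : realType) (V : vectorLatticeType R).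
Implicit Types (a b c d p q u v x y z : V) (r s : R).

Lemma vlexx x : x <=v x.
Proof. exact: vle_refl. Qed.

Lemma vler_trans y x z : x <=v y -> y <=v z -> x <=v z.
Proof. exact: vle_trans. Qed.

Lemma vle_eq x y : x <=v y -> y <=v x -> x = y.
Proof. by move=> xy yx; apply: vle_anti; rewrite xy yx. Qed.

Lemma vleD x y z t : x <=v y -> z <=v t -> x + z <=v y + t.
Proof.
move=> xy zt; apply: (@vler_trans (y + z)); first exact: vle_add2r.
by rewrite ![y + _]addrC; apply: vle_add2r.
Qed.

Lemma vsubr_ge0 x y : (0 <=v y - x) = (x <=v y).
Proof.
apply/idP/idP => h.
  by have := vle_add2r _ _ x h; rewrite add0r subrK.
by have := vle_add2r _ _ (- x) h; rewrite subrr.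
Qed.

Lemma vle_subl x y z : (x - y <=v z) = (x <=v z + y).
Proof. by rewrite -vsubr_ge0 opprB addrA vsubr_ge0. Qed.

Lemma vleN x y : (- x <=v - y) = (y <=v x).
Proof. by rewrite -vsubr_ge0 opprK addrC vsubr_ge0. Qed.

Lemma vaddr_ge0 x y : 0 <=v x -> 0 <=v y -> 0 <=v x + y.
Proof. by move=> x0 y0; rewrite -[0]addr0; apply: vleD. Qed.

Lemma vlerDl x y : 0 <=v y -> x <=v x + y.
Proof. by move=> y0; rewrite -{1}[x]addr0; apply: vleD => //; exact: vlexx. Qed.

Lemma vlerDr x y : 0 <=v y -> x <=v y + x.
Proof. by rewrite addrC; apply: vlerDl. Qed.

Lemma vscale_ge0 r x : 0 <= r -> 0 <=v x -> 0 <=v r *: x.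
Proof. exact: vle_scale_ge0. Qed.

Lemma vleZ r x y : 0 <= r -> x <=v y -> r *: x <=v r *: y.
Proof.
by move=> r0; rewrite -vsubr_ge0 => xy; rewrite -vsubr_ge0 -scalerBr vscale_ge0.
Qed.

Lemma vleZl r s x : 0 <=v x -> r <= s -> r *: x <=v s *: x.
Proof.
by move=> x0 rs; rewrite -vsubr_ge0 -scalerBl vscale_ge0 ?subr_ge0.
Qed.

Lemma vjoinl x y : x <=v x `\/` y.
Proof. by have := vle_joinl x y (x `\/` y); rewrite vlexx => /esym/andP[]. Qed.

Lemma vjoinr x y : y <=v x `\/` y.
Proof. by have := vle_joinl x y (x `\/` y); rewrite vlexx => /esym/andP[]. Qed.

Lemma vmeetl x y : x `/\` y <=v x.
Proof. by have := vle_meetr x y (x `/\` y); rewrite vlexx => /esym/andP[]. Qed.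

Lemma vmeetr x y : x `/\` y <=v y.
Proof. by have := vle_meetr x y (x `/\` y); rewrite vlexx => /esym/andP[]. Qed.

Lemma vjoin_le x y z : x <=v z -> y <=v z -> x `\/` y <=v z.
Proof. by rewrite vle_joinl => -> ->. Qed.

Lemma vmeet_ge x y z : z <=v x -> z <=v y -> z <=v x `/\` y.
Proof. by rewrite vle_meetr => -> ->. Qed.

Lemma vjoinC x y : x `\/` y = y `\/` x.
Proof. by apply: vle_eq; apply: vjoin_le; rewrite ?vjoinl ?vjoinr. Qed.

Lemma vmeetC x y : x `/\` y = y `/\` x.
Proof. by apply: vle_eq; apply: vmeet_ge; rewrite ?vmeetl ?vmeetr. Qed.

Lemma vmeetE x y : x `/\` y = - ((- x) `\/` (- y)).
Proof.
apply: vle_eq.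
  by rewrite -vleN opprK; apply: vjoin_le; rewrite vleN ?vmeetl ?vmeetr.
by apply: vmeet_ge; rewrite -vleN opprK ?vjoinl ?vjoinr.
Qed.

Lemma vjoinDr x y z : (x `\/` y) + z = (x + z) `\/` (y + z).
Proof.
apply: vle_eq; last first.
  by apply: vjoin_le; apply: vle_add2r; rewrite ?vjoinl ?vjoinr.
have h : x `\/` y <=v ((x + z) `\/` (y + z)) - z.
  by apply: vjoin_le; rewrite -[X in X <=v _](addrK z); apply: vle_add2r;
    rewrite ?vjoinl ?vjoinr.
by have := vle_add2r _ _ z h; rewrite subrK.
Qed.

Lemma vmeet_ge0 x y : 0 <=v x -> 0 <=v y -> 0 <=v x `/\` y.
Proof. exact: vmeet_ge. Qed.

Lemma vmeet_le2 x y z t : x <=v z -> y <=v t -> x `/\` y <=v z `/\` t.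
Proof.
move=> xz yt; apply: vmeet_ge.
  exact: vler_trans (vmeetl _ _) xz.
exact: vler_trans (vmeetr _ _) yt.
Qed.

Lemma vmeet0_le p q u : 0 <=v p -> 0 <=v u -> p <=v q -> q `/\` u = 0 ->
  p `/\` u = 0.
Proof.
move=> p0 u0 pq qu; apply: vle_eq; last exact: vmeet_ge0.
by rewrite -qu; apply: vmeet_le2 => //; exact: vlexx.
Qed.

Lemma vmeet_idl x y : x <=v y -> x `/\` y = x.
Proof.
move=> xy; apply: vle_eq; first exact: vmeetl.
by apply: vmeet_ge => //; exact: vlexx.
Qed.

(** The distributive inequality behind everything disjoint: it makes the
    elements disjoint from [u] a subspace. *)
Lemma vmeetDl_le p q u : 0 <=v p -> 0 <=v q -> 0 <=v u ->
  (p + q) `/\` u <=v p `/\` u + q `/\` u.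
Proof.
move=> p0 q0 u0; rewrite -vle_subl; apply: vmeet_ge.
  rewrite vle_subl [X in _ <=v X]addrC -vle_subl; apply: vmeet_ge.
    by rewrite vle_subl [q + p]addrC; exact: vmeetl.
  by rewrite vle_subl; apply: (vler_trans (vmeetr _ _)); exact: vlerDl.
rewrite vle_subl; apply: (vler_trans (vmeetr _ _)); apply: vlerDl.
exact: vmeet_ge0.
Qed.

Lemma vmeetZ r p q : 0 < r -> r *: (p `/\` q) = (r *: p) `/\` (r *: q).
Proof.
move=> r0; have r0' := ltW r0.
apply: vle_eq; first by apply: vmeet_ge; apply: vleZ; rewrite ?vmeetl ?vmeetr.
have ri : 0 <= r^-1 by rewrite invr_ge0.
have h : r^-1 *: ((r *: p) `/\` (r *: q)) <=v p `/\` q.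
  apply: vmeet_ge; [have := vleZ ri (vmeetl (r *: p) (r *: q))
    | have := vleZ ri (vmeetr (r *: p) (r *: q))];
    by rewrite scalerA mulVf ?scale1r// gt_eqF.
by have := vleZ r0' h; rewrite scalerA mulfV ?scale1r// gt_eqF.
Qed.

Lemma vjoinZ r p q : 0 <= r -> r *: (p `\/` q) = (r *: p) `\/` (r *: q).
Proof.
rewrite le_eqVlt => /orP[/eqP <-|r0].
  rewrite !scale0r; apply: vle_eq; first exact: vjoinl.
  by apply: vjoin_le; exact: vlexx.
have := vmeetZ (- p) (- q) r0.
by rewrite !vmeetE !scalerN !opprK => /oppr_inj.
Qed.

Lemma vabsN x : vabs (- x) = vabs x.
Proof. by rewrite /vabs opprK vjoinC. Qed.

Lemma vle_abs x : x <=v vabs x.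
Proof. exact: vjoinl. Qed.

Lemma vleN_abs x : - x <=v vabs x.
Proof. exact: vjoinr. Qed.

Lemma vabs_ge0 x : 0 <=v vabs x.
Proof.
have h := vleD (vle_abs x) (vleN_abs x).
rewrite subrr in h.
have -> : vabs x = (2^-1) *: (vabs x + vabs x).
  by rewrite scalerDr -scalerDl (_ : 2^-1 + 2^-1 = 1) ?scale1r//; lra.
by apply: vscale_ge0 => //; rewrite invr_ge0.
Qed.

Lemma vabs_ge0_id x : 0 <=v x -> vabs x = x.
Proof.
move=> x0; apply: vle_eq; last exact: vle_abs.
apply: vjoin_le; first exact: vlexx.
by apply: (vler_trans _ x0); rewrite -[X in _ <=v X]oppr0 vleN.
Qed.

Lemma vabs_id x : vabs (vabs x) = vabs x.
Proof. exact/vabs_ge0_id/vabs_ge0. Qed.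

Definition vpos x := x `\/` 0.

Lemma vpos_ge0 x : 0 <=v vpos x.
Proof. exact: vjoinr. Qed.

Lemma vle_vpos x : x <=v vpos x.
Proof. exact: vjoinl. Qed.

Lemma vpos_le x y : x <=v y -> 0 <=v y -> vpos x <=v y.
Proof. exact: vjoin_le. Qed.

Lemma vpos_eq0 x : (vpos x == 0) = (x <=v 0).
Proof.
apply/eqP/idP => [<-|x0]; first exact: vle_vpos.
by apply: vle_eq (vpos_ge0 x); apply: vpos_le => //; exact: vlexx.
Qed.

Lemma vposB x : vpos x - vpos (- x) = x.
Proof.
have -> : vpos (- x) = vpos x - x.
  by rewrite /vpos [X in _ = X - x]vjoinC vjoinDr sub0r subrr.
by rewrite opprB addrC subrK.
Qed.

Lemma vpos_disj x : vpos x `/\` vpos (- x) = 0.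
Proof.
have e : vpos (- x) = vpos x - x.
  by rewrite -[X in _ = _ - X](vposB x) opprB addrCA subrr addr0.
apply: vle_eq; last by apply: vmeet_ge0; exact: vpos_ge0.
set m := _ `/\` _.
have : vpos x <=v vpos x - m.
  apply: vpos_le.
    rewrite -vsubr_ge0 addrAC -e vsubr_ge0; exact: vmeetr.
  by rewrite vsubr_ge0; exact: vmeetl.
by rewrite -vsubr_ge0 addrAC subrr sub0r -[X in X <=v _]oppr0 vleN.
Qed.

Lemma vabsE x : vabs x = vpos x + vpos (- x).
Proof.
have h : vabs x + x = vpos x + vpos x.
  have -> : vpos x + vpos x = 2%:R *: vpos x by rewrite scaler_nat.
  by rewrite vjoinDr addNr vjoinZ// scaler0 scaler_nat mulr2n.
have -> : vpos (- x) = vpos x - x.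
  by rewrite -[X in _ = _ - X](vposB x) opprB addrCA subrr addr0.
by rewrite addrA -h addrK.
Qed.

Lemma vabsD_le x y : vabs (x + y) <=v vabs x + vabs y.
Proof.
apply: vjoin_le; first by apply: vleD; exact: vle_abs.
by rewrite opprD; apply: vleD; exact: vleN_abs.
Qed.

Lemma vabsZ r x : vabs (r *: x) = `|r| *: vabs x.
Proof.
have h (s : R) : 0 <= s -> vabs (s *: x) = s *: vabs x.
  by move=> s0; rewrite /vabs vjoinZ// scalerN.
case: (ger0P r) => r0; first exact: h.
by rewrite -h ?oppr_ge0 1?ltW// scaleNr vabsN.
Qed.

(** The join is uniformly continuous for the order. *)
Lemma vabs_join_le (x y z t : V) :
  vabs ((x `\/` y) - (z `\/` t)) <=v vabs (x - z) + vabs (y - t).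
Proof.
have h (a b c d : V) : (a `\/` b) - (c `\/` d) <=v vabs (a - c) + vabs (b - d).
  rewrite vle_subl; apply: vjoin_le.
    apply: (@vler_trans (vabs (a - c) + c)).
      by rewrite -vle_subl; exact: vle_abs.
    apply: vleD; last exact: vjoinl.
    by apply: vlerDl; exact: vabs_ge0.
  apply: (@vler_trans (vabs (b - d) + d)).
    by rewrite -vle_subl; exact: vle_abs.
  apply: vleD; last exact: vjoinr.
  by apply: vlerDr; exact: vabs_ge0.
apply: vjoin_le; first exact: h.
by rewrite opprB -[vabs (x - z)]vabsN -[vabs (y - t)]vabsN !opprB; exact: h.
Qed.

(** The order of the quotient by the band of elements disjoint from [u], where
    [u >= 0]: a point-free way of saying that [a <= b] wherever [u > 0]. *)
Definition vlemod u a b := vpos (a - b) `/\` u = 0.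

Lemma vlemod_le u w a b : 0 <=v u -> 0 <=v w -> a - b <=v w -> w `/\` u = 0 ->
  vlemod u a b.
Proof.
move=> u0 w0 abw; apply: vmeet0_le => //; first exact: vpos_ge0.
exact: vpos_le.
Qed.

Lemma vle_mod u a b : 0 <=v u -> a <=v b -> vlemod u a b.
Proof.
move=> u0 ab; apply: (@vlemod_le u 0) => //; first exact: vlexx.
  by rewrite vle_subl add0r.
exact: vmeet_idl.
Qed.

Lemma vlemod_sub u v a b : 0 <=v v -> v <=v u -> vlemod u a b -> vlemod v a b.
Proof.
rewrite /vlemod => v0 vu; rewrite ![vpos _ `/\` _]vmeetC.
by apply: vmeet0_le => //; exact: vpos_ge0.
Qed.

Lemma vdisjD p q u : 0 <=v p -> 0 <=v q -> 0 <=v u -> p `/\` u = 0 ->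
  q `/\` u = 0 -> (p + q) `/\` u = 0.
Proof.
move=> p0 q0 u0 pu qu; apply: vle_eq; last first.
  by apply: vmeet_ge0 => //; exact: vaddr_ge0.
by have := vmeetDl_le p0 q0 u0; rewrite pu qu addr0.
Qed.

Lemma vdisjZ r p u : 0 <= r -> 0 <=v p -> 0 <=v u -> p `/\` u = 0 ->
  (r *: p) `/\` u = 0.
Proof.
move=> r0 p0 u0 pu.
have r1 : 0 < r + 1 by rewrite ltr_pwDr.
apply: vle_eq; last by apply: vmeet_ge0 => //; exact: vscale_ge0.
rewrite -(scaler0 _ (r + 1)) -pu vmeetZ//; apply: vmeet_le2.
  by apply: vleZl => //; rewrite lerDl.
by rewrite -{1}[u]scale1r; apply: vleZl => //; rewrite lerDr.
Qed.

Lemma vlemodD u a b a' b' : 0 <=v u -> vlemod u a b -> vlemod u a' b' ->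
  vlemod u (a + a') (b + b').
Proof.
move=> u0 ab ab'.
apply: (@vlemod_le u (vpos (a - b) + vpos (a' - b'))) => //.
- by apply: vaddr_ge0; exact: vpos_ge0.
- by rewrite opprD addrACA; apply: vleD; exact: vle_vpos.
- by apply: vdisjD => //; exact: vpos_ge0.
Qed.

Lemma vlemod_trans u b a c : 0 <=v u -> vlemod u a b -> vlemod u b c ->
  vlemod u a c.
Proof.
move=> u0 ab bc; have := vlemodD u0 ab bc; rewrite /vlemod.
by rewrite opprD addrA addrK.
Qed.

Lemma vlemodZ r u a b : 0 <= r -> 0 <=v u -> vlemod u a b ->
  vlemod u (r *: a) (r *: b).
Proof.
move=> r0 u0 ab; apply: (@vlemod_le u (r *: vpos (a - b))) => //.
- by apply: vscale_ge0 => //; exact: vpos_ge0.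
- by rewrite -scalerBr; apply: vleZ => //; exact: vle_vpos.
- by apply: vdisjZ => //; exact: vpos_ge0.
Qed.

Lemma vlemodN u a b : vlemod u a b -> vlemod u (- b) (- a).
Proof. by rewrite /vlemod opprK addrC. Qed.

Lemma vlemod_join u a b c : 0 <=v u -> vlemod u a c -> vlemod u b c ->
  vlemod u (a `\/` b) c.
Proof.
move=> u0 ac bc; apply: (@vlemod_le u (vpos (a - c) + vpos (b - c))) => //.
- by apply: vaddr_ge0; exact: vpos_ge0.
- rewrite vjoinDr; apply: vjoin_le.
    by apply: (vler_trans (vle_vpos _)); apply: vlerDl; exact: vpos_ge0.
  by apply: (vler_trans (vle_vpos _)); apply: vlerDr; exact: vpos_ge0.
- by apply: vdisjD => //; exact: vpos_ge0.
Qed.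

(** The way back from the order modulo a band to the order of the space. *)
Lemma vlemod_meet_le u a b : 0 <=v u -> 0 <=v b -> vlemod u a b ->
  a `/\` u <=v b.
Proof.
move=> u0 b0 ab.
have h : a <=v b + vpos (a - b).
  by rewrite [X in _ <=v X]addrC -vle_subl; exact: vle_vpos.
apply: (vler_trans (vmeet_le2 h (vlexx u))).
apply: (vler_trans (vmeetDl_le b0 (vpos_ge0 _) u0)).
by rewrite ab addr0; exact: vmeetl.
Qed.

(** If [a <= b] fails, then [vpos (a - b)] is nonzero, and on its support the
    opposite inequality holds: arguments by contradiction can be localized. *)
Lemma vlemod_pos a b : vlemod (vpos (a - b)) b a.
Proof. by rewrite /vlemod vmeetC -[b - a]opprB; exact: vpos_disj. Qed.

Lemma vlemod_vle_trans u x y z :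
  0 <=v u -> vlemod u x y -> y <=v z -> vlemod u x z.
Proof. by move=> u0 xy yz; apply: (vlemod_trans u0 xy); exact: vle_mod. Qed.

Lemma vle_vlemod_trans u x y z :
  0 <=v u -> x <=v y -> vlemod u y z -> vlemod u x z.
Proof. by move=> u0 xy yz; apply: (vlemod_trans u0 _ yz); exact: vle_mod. Qed.

Lemma vlemodxx u a : 0 <=v u -> vlemod u a a.
Proof. by move=> u0; apply: vle_mod => //; exact: vlexx. Qed.

End VectorLatticeTheory.

(** * f-algebras and their norms *)
Section FAlgebraTheory.
Variables (R : realType) (A : fAlgType R).
Implicit Types (a b c u x y : A) (r : R).

Lemma v0mul x : (0%R * x)%g = 0 :> A.
Proof. by have := vla_scaleAl 0 x x; rewrite !scale0r. Qed.

Lemma vmulN x y : (x * (- y)%R)%g = - (x * y)%g :> A.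
Proof. by rewrite -scaleN1r vla_scaleAr scaleN1r. Qed.

Lemma vNmul x y : ((- x)%R * y)%g = - (x * y)%g :> A.
Proof. by rewrite -scaleN1r vla_scaleAl scaleN1r. Qed.

Lemma vmul_le2l c a b : 0 <=v c -> a <=v b -> (c * a)%g <=v (c * b)%g.
Proof.
move=> c0; rewrite -vsubr_ge0 => ab.
by rewrite -vsubr_ge0 -vmulN -vla_mulDr vla_mul_ge0.
Qed.

Lemma vmul_le2r c a b : 0 <=v c -> a <=v b -> (a * c)%g <=v (b * c)%g.
Proof.
move=> c0; rewrite -vsubr_ge0 => ab.
by rewrite -vsubr_ge0 -vNmul -vla_mulDl vla_mul_ge0.
Qed.

(** This is where the f-algebra axiom enters: a band is also an ideal for the
    product. *)
Lemma vlemod_mull u c a b : 0 <=v u -> 0 <=v c -> vlemod u a b ->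
  vlemod u (c * a)%g (c * b)%g.
Proof.
move=> u0 c0 ab; apply: (@vlemod_le _ _ u (c * vpos (a - b))%g) => //.
- by apply: vla_mul_ge0 => //; exact: vpos_ge0.
- by rewrite -vmulN -vla_mulDr; apply: vmul_le2l => //; exact: vle_vpos.
- exact: falg_mull_disj.
Qed.

Lemma vlemod_mulr u c a b : 0 <=v u -> 0 <=v c -> vlemod u a b ->
  vlemod u (a * c)%g (b * c)%g.
Proof.
move=> u0 c0 ab; apply: (@vlemod_le _ _ u (vpos (a - b) * c)%g) => //.
- by apply: vla_mul_ge0 => //; exact: vpos_ge0.
- by rewrite -vNmul -vla_mulDl; apply: vmul_le2r => //; exact: vle_vpos.
- exact: falg_mulr_disj.
Qed.

(** [a `\/` b] exceeds [a] and [b] by two disjoint amounts, whose products with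
    [y] remain disjoint. *)
Lemma vjoin_mul_le a b y : 0 <=v y -> (a * y)%g <=v y -> (b * y)%g <=v y ->
  ((a `\/` b) * y)%g <=v y.
Proof.
move=> y0 ay bY.
have ea : a `\/` b = vpos (b - a) + a.
  by rewrite /vpos vjoinDr subrK add0r vjoinC.
have eb : a `\/` b = vpos (a - b) + b.
  by rewrite /vpos vjoinDr subrK add0r.
have := vpos_disj (a - b); rewrite opprB => /falg_mulr_disj-/(_ _ y0).
rewrite vmeetC => /falg_mulr_disj-/(_ _ y0) d.
rewrite -[X in _ <=v X]add0r -vle_subl -d; apply: vmeet_ge.
  by rewrite ea vla_mulDl vle_subl; apply: vleD => //; exact: vlexx.
by rewrite eb vla_mulDl vle_subl; apply: vleD => //; exact: vlexx.
Qed.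

Lemma vabsM_le a b :
  vabs (a * b)%g <=v (vabs a * vabs b)%g.
Proof.
have h (c d : A) : (c * d)%g <=v (vabs c * vabs d)%g.
  rewrite -[X in (X * d)%g](vposB c) vla_mulDl vNmul -vmulN vabsE vla_mulDl.
  apply: vleD; apply: vmul_le2l; rewrite ?vpos_ge0//; first exact: vle_abs.
  exact: vleN_abs.
apply: vjoin_le; first exact: h.
by rewrite -vmulN -[vabs b]vabsN; exact: h.
Qed.

End FAlgebraTheory.

Section BanachFAlgebraTheory.
Variables (R : realType) (A : banachFAlgType R).
Implicit Types (a b c u x y : A) (r : R).

Lemma vnorm_abs x : `|vabs x| = `|x|.
Proof.
by apply: le_anti; apply/andP; split; apply: bfalg_lattice_norm;
  rewrite vabs_id; exact: vlexx.
Qed.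

Lemma vnorm_le x y : 0 <=v x -> x <=v y -> `|x| <= `|y|.
Proof.
move=> x0 xy; apply: bfalg_lattice_norm; rewrite !vabs_ge0_id//.
exact: vler_trans xy.
Qed.

Lemma vnorm_abs_le x y : vabs x <=v y -> `|x| <= `|y|.
Proof.
by move=> xy; rewrite -vnorm_abs; apply: vnorm_le => //; exact: vabs_ge0.
Qed.

(** The positive cone is closed for the norm. *)
Lemma vle_eps a b :
  (forall r, 0 < r -> exists2 d, `|d| <= r & a <=v b + d) -> a <=v b.
Proof.
move=> h; rewrite -vsubr_ge0 -oppr0 -[b - a]opprB vleN -vpos_eq0 -normr_eq0.
apply/eqP/le_anti; rewrite normr_ge0 andbT; apply/ler_addgt0Pr => r r0.
rewrite add0r; have [d dr abd] := h r r0.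
rewrite (le_trans _ dr)// -(vnorm_abs d).
apply: vnorm_le; first exact: vpos_ge0.
apply: vpos_le; last exact: vabs_ge0.
rewrite vle_subl addrC; apply: (vler_trans abd).
by apply: vleD; [exact: vlexx | exact: vle_abs].
Qed.

Lemma vle_archi a b c : (forall r, 0 < r -> a <=v b + r *: c) -> a <=v b.
Proof.
move=> h; apply: vle_eps => r r0.
have c1 : 0 < `|c| + 1 by rewrite ltr_wpDl.
exists ((r / (`|c| + 1)) *: c); last by apply: h; rewrite divr_gt0.
rewrite normrZ ger0_norm; last by rewrite divr_ge0// ltW.
rewrite mulrAC ler_pdivrMr//.
by rewrite ler_pM2l// lerDl.
Qed.

(** This is the bound by [1] of the multiplication by [a], read off from its
    powers: on the band where [a * b >= r b] one gets [a^k * b >= r^k b], which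
    [|a| < r] allows only if [b] vanishes there. *)
Lemma vmull_le a b : 0 <=v a -> 0 <=v b -> (a * b)%g <=v `|a| *: b.
Proof.
move=> a0 b0; pose L y := (a * y)%g.
suff h r : `|a| < r -> L b <=v r *: b.
  apply: (@vle_archi _ _ b) => r r0; rewrite -scalerDl; apply: h.
  by rewrite ltrDl.
move=> ar; have r0 : 0 < r by exact: le_lt_trans ar.
set u := vpos (L b - r *: b); have u0 : 0 <=v u by exact: vpos_ge0.
have hu : vlemod u (r *: b) (L b) by exact: vlemod_pos.
have Lk0 k : 0 <=v iter k L b by elim: k => //= k; exact: vla_mul_ge0.
have hk k : vlemod u (r ^+ k *: b) (iter k L b).
  elim: k => [|k IH]; first by rewrite scale1r; exact: vlemodxx.
  apply: (@vlemod_trans _ _ _ (L (r ^+ k *: b))) => //.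
    rewrite /L vla_scaleAr exprSr -scalerA.
    by apply: vlemodZ => //; rewrite exprn_ge0 ?ltW.
  exact: vlemod_mull.
have nk k : `|iter k L b| <= `|a| ^+ k * `|b|.
  elim: k => [|k IH]; first by rewrite mul1r.
  rewrite exprS -mulrA /=; apply: (le_trans (bfalg_normM _ _)).
  by rewrite ler_wpM2l.
have bu k : `|b `/\` u| <= (`|a| / r) ^+ k * `|b|.
  have rk : 0 < r ^+ k by rewrite exprn_gt0.
  have rk' : 0 <= (r ^+ k)^-1 by rewrite invr_ge0 ltW.
  have h : vlemod u b ((r ^+ k)^-1 *: iter k L b).
    have := vlemodZ rk' u0 (hk k).
    by rewrite scalerA mulVf ?gt_eqF// scale1r.
  have := vlemod_meet_le u0 (vscale_ge0 rk' (Lk0 k)) h.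
  move=> /vnorm_le-/(_ (vmeet_ge0 b0 u0))/le_trans; apply.
  rewrite normrZ ger0_norm//.
  by rewrite exprMn exprVn mulrC mulrAC ler_pM2r ?invr_gt0.
have bu0 : b `/\` u = 0.
  apply/eqP; rewrite -normr_eq0 eq_le normr_ge0 andbT.
  have cv : ((((`|a| / r) ^+ k * `|b|) @[k --> \oo]) --> 0 * `|b|)%classic.
    apply: cvgMl; apply: cvg_expr.
    by rewrite ger0_norm ?ltr_pdivrMr ?mul1r// divr_ge0// ltW.
  rewrite mul0r in cv.
  rewrite -(cvg_lim _ cv)//; apply: limr_ge; first exact: cvgP cv.
  by apply: nearW => k; exact: bu.
have u_eq0 : u = 0.
  rewrite -(falg_mull_disj _ _ _ bu0 a0) vmeetC vmeet_idl//.
  apply: vpos_le; last exact: vla_mul_ge0.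
  by rewrite vle_subl; apply: vlerDl; apply: vscale_ge0 => //; exact: ltW.
by have : u == 0 by [rewrite u_eq0]; rewrite vpos_eq0 vle_subl add0r.
Qed.

End BanachFAlgebraTheory.

(** * The free algebra is generated by its generators *)

(** Closed vector sublattices that are subalgebras. Meets and opposites are
    obtained from joins and scalar multiples, and closedness is phrased with
    approximations. *)
Record closedSub (R : realType) (F : banachFAlgType R) := ClosedSub {
  csub_mem :> F -> Prop ;
  csubD : forall f g, csub_mem f -> csub_mem g -> csub_mem (f + g) ;
  csubZ : forall (r : R) f, csub_mem f -> csub_mem (r *: f) ;
  csub_join : forall f g, csub_mem f -> csub_mem g -> csub_mem (f `\/` g) ;
  csubM : forall f g, csub_mem f -> csub_mem g -> csub_mem (f * g)%g ;
  csub0 : csub_mem 0 ;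
  csub_closed : forall f,
    (forall r, 0 < r -> exists2 g, csub_mem g & `|f - g| <= r) -> csub_mem f
}.

Section ClosedSub.
Variables (R : realType) (F : banachFAlgType R) (P : closedSub F).

Definition csub_pred : {pred F} := fun f => `[< P f >].

Lemma csub_predE f : (f \in csub_pred) <-> P f.
Proof. by split=> /asboolP. Qed.

Lemma csub_submod : submod_closed csub_pred.
Proof.
split; first exact/csub_predE/csub0.
by move=> r f g /csub_predE Pf /csub_predE Pg; apply/csub_predE/csubD/Pg/csubZ.
Qed.

HB.instance Definition _ :=
  GRing.isSubmodClosed.Build R F csub_pred csub_submod.

Definition csub : Type := {f : F | csub_pred f}.

HB.instance Definition _ := [isSub of csub for @sval F csub_pred].
HB.instance Definition _ := [Choice of csub by <:].
HB.instance Definition _ := [SubChoice_isSubLmodule of csub by <:].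

Implicit Types x y z : csub.

Lemma csubP x : P (val x).
Proof. exact/csub_predE/(valP x). Qed.

Definition csub_mk (f : F) (Pf : P f) : csub :=
  exist _ f (introT (asboolP _) Pf).

Lemma csub_meet_subproof x y : P (val x `/\` val y).
Proof.
have PN f : P f -> P (- f) by rewrite -[- f]scaleN1r; exact: csubZ.
by rewrite vmeetE; apply/PN/csub_join; apply/PN/csubP.
Qed.

Definition csub_vjoin x y := csub_mk (csub_join (csubP x) (csubP y)).
Definition csub_vmeet x y := csub_mk (csub_meet_subproof x y).
Definition csub_vle x y := val x <=v val y.
Definition csub_mul x y := csub_mk (csubM (csubP x) (csubP y)).

Lemma csub_vle_refl : reflexive csub_vle.
Proof. by move=> x; exact: vlexx. Qed.
Lemma csub_vle_anti : antisymmetric csub_vle.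
Proof. by move=> x y /vle_anti /val_inj. Qed.
Lemma csub_vle_trans : transitive csub_vle.
Proof. by move=> y x z; exact: vle_trans. Qed.

HB.instance Definition _ := @Lmodule_isVectorLattice.Build R csub
  csub_vle csub_vjoin csub_vmeet csub_vle_refl csub_vle_anti csub_vle_trans
  (fun x y z => vle_joinl (val x) (val y) (val z))
  (fun x y z => vle_meetr (val x) (val y) (val z))
  (fun x y z => vle_add2r (val x) (val y) (val z))
  (fun a x => vle_scale_ge0 a (val x)).

Lemma csub_mulA : associative csub_mul.
Proof. by move=> x y z; apply: val_inj; exact: mulgA. Qed.

HB.instance Definition _ := isSemigroup.Build csub csub_mulA.

Lemma csub_mulDl x y z : ((x + y)%R * z)%g = (x * z)%g + (y * z)%g :> csub.
Proof. by apply: val_inj; exact: vla_mulDl. Qed.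
Lemma csub_mulDr x y z : (x * (y + z)%R)%g = (x * y)%g + (x * z)%g :> csub.
Proof. by apply: val_inj; exact: vla_mulDr. Qed.
Lemma csub_scaleAl (a : R) x y : ((a *: x)%R * y)%g = a *: (x * y)%g :> csub.
Proof. by apply: val_inj; exact: vla_scaleAl. Qed.
Lemma csub_scaleAr (a : R) x y : (x * (a *: y)%R)%g = a *: (x * y)%g :> csub.
Proof. by apply: val_inj; exact: vla_scaleAr. Qed.

HB.instance Definition _ := VectorLattice_isVectorLatticeAlgebra.Build R csub
  csub_mulDl csub_mulDr csub_scaleAl csub_scaleAr
  (fun x y => vla_mul_ge0 (val x) (val y)).

Lemma csub_mulr_disj x y z : x `/\` y = 0 -> 0 <=v z -> (x * z)%g `/\` y = 0.
Proof.
by move=> /(congr1 val)/= xy z0; apply: val_inj; exact: falg_mulr_disj.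
Qed.
Lemma csub_mull_disj x y z : x `/\` y = 0 -> 0 <=v z -> (z * x)%g `/\` y = 0.
Proof.
by move=> /(congr1 val)/= xy z0; apply: val_inj; exact: falg_mull_disj.
Qed.

HB.instance Definition _ := VectorLatticeAlgebra_isFAlgebra.Build R csub
  csub_mulr_disj csub_mull_disj.

Definition csub_norm x : R := `|val x|.

Lemma csub_normD x y : csub_norm (x + y) <= csub_norm x + csub_norm y.
Proof. exact: ler_normD. Qed.
Lemma csub_normZ (a : R) x : csub_norm (a *: x) = `|a| * csub_norm x.
Proof. exact: normrZ. Qed.
Lemma csub_norm0_eq0 x : csub_norm x = 0 -> x = 0.
Proof. by move/normr0_eq0 => x0; exact: val_inj. Qed.

HB.instance Definition _ := Lmodule_isNormed.Build R csub
  csub_normD csub_normZ csub_norm0_eq0.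

Lemma csub_complete (G : set_system csub) : ProperFilter G -> cauchy G -> cvg G.
Proof.
move=> GG /cauchy_ballP Gc.
have cG : cvg ((val : csub -> F) @ G)%classic.
  apply: cauchy_cvg; apply/cauchy_ballP => e e0.
  rewrite near_map2; apply: filterS (Gc e e0) => -[x y] /=.
  by rewrite -!ball_normE.
set l := lim ((val : csub -> F) @ G)%classic in cG.
have Pl : P l.
  apply: csub_closed => r r0; move/cvgrPdist_le: cG => /(_ r r0) /= /filter_ex.
  by move=> [x xr]; exists (val x) => //; exact: csubP.
apply/cvg_ex; exists (csub_mk Pl); apply/cvgrPdist_le => e e0.
by move/cvgrPdist_le: cG => /(_ e e0).
Qed.

HB.instance Definition _ := Uniform_isComplete.Build csub csub_complete.

Lemma csub_lattice_norm x y : vabs x <=v vabs y -> `|x| <= `|y|.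
Proof. exact: (@bfalg_lattice_norm _ F (val x) (val y)). Qed.
Lemma csub_normM x y : `|(x * y)%g| <= `|x| * `|y|.
Proof. exact: (@bfalg_normM _ F (val x) (val y)). Qed.

HB.instance Definition _ := FAlgebra_isBanachFAlgebra.Build R csub
  csub_lattice_norm csub_normM.

End ClosedSub.

Lemma opnorm_le1 (R : realType) (V W : normedModType R) (T : {linear V -> W}) :
  (forall x, `|T x| <= `|x|) -> contractive T.
Proof.
move=> Tx; apply: ge_ereal_sup => _ [x /= x1 <-].
by rewrite lee_fin (le_trans (Tx x)).
Qed.

(** The closed subalgebra is itself a Banach f-algebra through which the
    generators factor. The homomorphism that the universal property then gives,
    followed by the inclusion, is an endomorphism that fixes the generators, so
    it is the identity. *)
Lemma FBfA_generated (R : realType) (E : completeNormedModType R)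
    (F : banachFAlgType R) (eta : {linear E -> F}) (P : closedSub F) :
  is_FBfA eta -> (forall x, P (eta x)) -> forall f, P f.
Proof.
move=> [eta_iso univ] Peta f.
have eta_contr : contractive eta by apply: opnorm_le1 => x; rewrite eta_iso.
pose T0 (x : E) : csub P := csub_mk (Peta x).
have T0_lin : linear T0 by move=> a x y; apply: val_inj; rewrite /= linearP.
pose T : {linear E -> csub P} :=
  HB.pack T0 (GRing.isLinear.Build R E (csub P) _ T0 T0_lin).
have T_contr : contractive T by apply: opnorm_le1 => x; rewrite -eta_iso.
have [S [[[Sj Sm SM] Seta] _ _]] := univ _ T T_contr.
have [S0 [_ _ uniq]] := univ _ eta eta_contr.
have i0_lin : linear (val : csub P -> F) by move=> a x y.
pose i : {linear csub P -> F} :=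
  HB.pack (val : csub P -> F) (GRing.isLinear.Build R (csub P) F _ _ i0_lin).
have iS : is_extension eta eta (i \o S).
  split; last by move=> x; rewrite /= Seta.
  by split=> x y /=; rewrite ?Sj ?Sm ?SM.
have id_ext : is_extension eta eta (idfun : {linear F -> F}) by [].
by have := uniq _ id_ext f; rewrite -(uniq _ iS f) /= => ->; exact: csubP.
Qed.

(** * Finite-dimensional semiprime Banach f-algebras *)

(** The norm is given on plain functions, and its monotonicity in the moduli
    makes it a lattice norm. That it dominates the coordinates makes it definite
    and, with monotonicity, equivalent to the supremum norm. *)
Record weightedNorm (R : realType) (J : finType) := WeightedNorm {
  weight : J -> R ;
  wnorm : (J -> R) -> R ;
  weight_gt0 : forall j, 0 < weight j ;
  wnormD : forall t s, wnorm (fun j => t j + s j) <= wnorm t + wnorm s ;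
  wnormZ : forall a t, wnorm (fun j => a * t j) = `|a| * wnorm t ;
  wnorm_mono : forall t s, (forall j, `|t j| <= `|s j|) -> wnorm t <= wnorm s ;
  wnorm_ge : forall t j, `|t j| <= wnorm t ;
  wnormM : forall t s,
    wnorm (fun j => weight j * t j * s j) <= wnorm t * wnorm s
}.

(** The parameter [D] occurs in the name of the type only so that the product
    and the norm can be inferred from it. *)
Definition walg (R : realType) (J : finType) (D : weightedNorm R J) : Type :=
  {ffun J -> R^o}.

HB.instance Definition _ (R : realType) (J : finType) (D : weightedNorm R J) :=
  GRing.Lmodule.copy (walg D) {ffun J -> R^o}.

Section WeightedAlgebra.
Variables (R : realType) (J : finType) (D : weightedNorm R J).
Local Notation walg := (walg D).

Implicit Types x y z : walg.

(** Reading a coordinate through a name of its own keeps the scalars in [R]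
    rather than in the module [R^o]. *)
Definition wcoord x (j : J) : R := x j.

Lemma wcoordD x y j : wcoord (x + y) j = wcoord x j + wcoord y j.
Proof. by rewrite /wcoord ffunE. Qed.
Lemma wcoordZ (a : R) x j : wcoord (a *: x) j = a * wcoord x j.
Proof. by rewrite /wcoord ffunE. Qed.
Lemma wcoord0 j : wcoord 0 j = 0.
Proof. by rewrite /wcoord ffunE. Qed.

Lemma wcoordN x j : wcoord (- x) j = - wcoord x j.
Proof. by rewrite /wcoord ffunE. Qed.

Definition wmk (t : J -> R) : walg := [ffun j => t j : R^o].

Lemma wcoord_mk t j : wcoord (wmk t) j = t j.
Proof. by rewrite /wcoord ffunE. Qed.

Lemma walgP x y : (forall j, wcoord x j = wcoord y j) -> x = y.
Proof. by move=> xy; apply/ffunP. Qed.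

Definition walg_vle : rel walg :=
  fun x y => [forall j, wcoord x j <= wcoord y j].
Definition walg_join x y := wmk (fun j => Num.max (wcoord x j) (wcoord y j)).
Definition walg_meet x y := wmk (fun j => Num.min (wcoord x j) (wcoord y j)).
Definition walg_mul x y := wmk (fun j => weight D j * wcoord x j * wcoord y j).

Lemma walg_vle_refl : reflexive walg_vle.
Proof. by move=> x; apply/forallP. Qed.
Lemma walg_vle_anti : antisymmetric walg_vle.
Proof.
move=> x y /andP[/forallP xy /forallP yx]; apply: walgP => j.
by apply: le_anti; rewrite xy yx.
Qed.
Lemma walg_vle_trans : transitive walg_vle.
Proof.
move=> y x z /forallP xy /forallP yz.
by apply/forallP => j; exact: le_trans (yz j).
Qed.
Lemma walg_joinl x y z :
  walg_vle (walg_join x y) z = walg_vle x z && walg_vle y z.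
Proof.
apply/forallP/andP => [h|[/forallP h1 /forallP h2] j].
  split; apply/forallP => j; have := h j;
  by rewrite wcoord_mk ge_max => /andP[].
by rewrite wcoord_mk ge_max h1 h2.
Qed.
Lemma walg_meetr x y z :
  walg_vle z (walg_meet x y) = walg_vle z x && walg_vle z y.
Proof.
apply/forallP/andP => [h|[/forallP h1 /forallP h2] j].
  split; apply/forallP => j; have := h j;
  by rewrite wcoord_mk le_min => /andP[].
by rewrite wcoord_mk le_min h1 h2.
Qed.
Lemma walg_add2r x y z : walg_vle x y -> walg_vle (x + z) (y + z).
Proof.
by move=> /forallP xy; apply/forallP => j; rewrite !wcoordD lerD2r.
Qed.
Lemma walg_scale_ge0 (a : R) x : 0 <= a -> walg_vle 0 x -> walg_vle 0 (a *: x).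
Proof.
move=> a0 /forallP x0; apply/forallP => j; have := x0 j.
by rewrite wcoordZ !wcoord0; exact: mulr_ge0.
Qed.

HB.instance Definition _ := @Lmodule_isVectorLattice.Build R walg
  walg_vle walg_join walg_meet walg_vle_refl walg_vle_anti walg_vle_trans
  walg_joinl walg_meetr walg_add2r walg_scale_ge0.

Lemma walg_mulA : associative walg_mul.
Proof.
move=> x y z; apply: walgP => j; rewrite !wcoord_mk.
by ring.
Qed.

HB.instance Definition _ := isSemigroup.Build walg walg_mulA.

Lemma wcoordM x y j : wcoord (x * y)%g j = weight D j * wcoord x j * wcoord y j.
Proof. exact: wcoord_mk. Qed.
Lemma wcoord_join x y j :
  wcoord (x `\/` y) j = Num.max (wcoord x j) (wcoord y j).
Proof. exact: wcoord_mk. Qed.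
Lemma wcoord_meet x y j :
  wcoord (x `/\` y) j = Num.min (wcoord x j) (wcoord y j).
Proof. exact: wcoord_mk. Qed.
Lemma wvleP x y : reflect (forall j, wcoord x j <= wcoord y j) (x <=v y).
Proof. exact: forallP. Qed.

Lemma walg_mulDl x y z : ((x + y)%R * z)%g = (x * z)%g + (y * z)%g :> walg.
Proof.
by apply: walgP => j; rewrite wcoordM !wcoordD !wcoordM mulrDr mulrDl.
Qed.
Lemma walg_mulDr x y z : (x * (y + z)%R)%g = (x * y)%g + (x * z)%g :> walg.
Proof.
by apply: walgP => j; rewrite wcoordM !wcoordD !wcoordM mulrDr.
Qed.
Lemma walg_scaleAl (a : R) x y : ((a *: x)%R * y)%g = a *: (x * y)%g :> walg.
Proof.
by apply: walgP => j; rewrite wcoordM !wcoordZ wcoordM mulrCA !mulrA.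
Qed.
Lemma walg_scaleAr (a : R) x y : (x * (a *: y)%R)%g = a *: (x * y)%g :> walg.
Proof. by apply: walgP => j; rewrite wcoordM !wcoordZ wcoordM mulrCA. Qed.
Lemma walg_mul_ge0 x y : 0 <=v x -> 0 <=v y -> 0 <=v (x * y)%g.
Proof.
move=> /wvleP x0 /wvleP y0; apply/wvleP => j; have := x0 j; have := y0 j.
rewrite wcoordM !wcoord0 => yj xj.
by rewrite !mulr_ge0// ltW// weight_gt0.
Qed.

HB.instance Definition _ := VectorLattice_isVectorLatticeAlgebra.Build R walg
  walg_mulDl walg_mulDr walg_scaleAl walg_scaleAr walg_mul_ge0.

Lemma min_pM_eq0 (a b c : R) :
  Num.min a b = 0 -> 0 <= c -> Num.min (a * c) b = 0.
Proof.
rewrite le_eqVlt => ab /orP[/eqP <-|c0].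
  rewrite mulr0; apply/min_idPl; rewrite -ab ge_min lexx orbT//.
have [a0 b0] : 0 <= a /\ 0 <= b by apply/andP; rewrite -le_min ab.
have : (a == 0) || (b == 0) by move: ab; case: leP => _ ->; rewrite eqxx ?orbT.
by move=> /orP[]/eqP ->; rewrite ?mul0r; [apply/min_idPl | apply/min_idPr];
  rewrite ?mulr_ge0// ltW.
Qed.

Lemma walg_mulr_disj x y z : x `/\` y = 0 -> 0 <=v z -> (x * z)%g `/\` y = 0.
Proof.
move=> xy /wvleP z0; apply: walgP => j; have := congr1 (wcoord^~ j) xy.
rewrite /= !wcoord_meet !wcoord0 wcoordM mulrAC mulrC mulrCA mulrC -mulrA.
move=> /min_pM_eq0; apply; have := z0 j; rewrite wcoord0 => zj.
by rewrite mulr_ge0// ltW// weight_gt0.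
Qed.

Lemma walg_mulC x y : (x * y)%g = (y * x)%g :> walg.
Proof. by apply: walgP => j; rewrite !wcoordM mulrAC. Qed.

Lemma walg_mull_disj x y z : x `/\` y = 0 -> 0 <=v z -> (z * x)%g `/\` y = 0.
Proof. by rewrite walg_mulC; exact: walg_mulr_disj. Qed.

HB.instance Definition _ := VectorLatticeAlgebra_isFAlgebra.Build R walg
  walg_mulr_disj walg_mull_disj.

Definition walg_norm x : R := wnorm D (wcoord x).

Lemma wnorm_eq t s : t =1 s -> wnorm D t = wnorm D s.
Proof.
by move=> ts; apply: le_anti; rewrite !wnorm_mono// => j; rewrite ts.
Qed.

Lemma walg_normD x y : walg_norm (x + y) <= walg_norm x + walg_norm y.
Proof.
apply: le_trans (wnormD _ _ _); rewrite le_eqVlt; apply/orP; left; apply/eqP.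
by apply: wnorm_eq => j; rewrite wcoordD.
Qed.
Lemma walg_normZ (a : R) x : walg_norm (a *: x) = `|a| * walg_norm x.
Proof. by rewrite -wnormZ; apply: wnorm_eq => j; rewrite wcoordZ. Qed.
Lemma walg_norm0_eq0 x : walg_norm x = 0 -> x = 0.
Proof.
move=> x0; apply: walgP => j; apply/eqP; rewrite wcoord0 -normr_eq0.
by rewrite eq_le normr_ge0 andbT -x0 wnorm_ge.
Qed.

HB.instance Definition _ := Lmodule_isNormed.Build R walg
  walg_normD walg_normZ walg_norm0_eq0.

Lemma walg_coord_le x j : `|wcoord x j| <= `|x|.
Proof. exact: wnorm_ge. Qed.

Lemma walg_norm_le x (r : R) : 0 <= r -> (forall j, `|wcoord x j| <= r) ->
  `|x| <= r * wnorm D (fun=> 1).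
Proof.
move=> r0 xr; rewrite -[r]ger0_norm// -wnormZ; apply: wnorm_mono => j.
by rewrite mulr1 [leRHS]ger0_norm.
Qed.

Lemma walg_complete (G : set_system walg) : ProperFilter G -> cauchy G -> cvg G.
Proof.
move=> GG /cauchy_ballP Gc.
have cG j : cvg ((wcoord^~ j) @ G)%classic.
  apply: R_complete; apply/cauchy_ballP => e e0.
  rewrite near_map2; apply: filterS (Gc e e0) => -[x y] /=.
  rewrite -!ball_normE /= => xy; apply: le_lt_trans xy.
  have := walg_coord_le (x - y) j.
  by rewrite wcoordD wcoordN.
pose l : walg := wmk (fun j => lim ((wcoord^~ j) @ G)%classic).
apply/cvg_ex; exists l; apply/cvgrPdist_le => /= e e0.
set M := wnorm D (fun=> 1).
have M0 : 0 <= M.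
  have <- : wnorm D (fun=> 0 * 1) = 0 by rewrite wnormZ normr0 mul0r.
  by apply: wnorm_mono => j; rewrite mul0r normr0.
have e0' : 0 < e / (M + 1) by rewrite divr_gt0// ltr_wpDl.
have H : G [set x : walg |
    forall j, `|wcoord l j - wcoord x j| <= e / (M + 1)]%classic.
  apply: filter_forall => j; have /cvgrPdist_le := cG j.
  by move=> /(_ _ e0'); rewrite wcoord_mk.
near=> x.
have xi : forall j, `|wcoord l j - wcoord x j| <= e / (M + 1) by near: x.
apply: (@le_trans _ _ (e / (M + 1) * M)).
  apply: walg_norm_le; first exact: ltW.
  by move=> j; have := xi j; rewrite wcoordD wcoordN.
by rewrite mulrAC ler_pdivrMr ?ltr_wpDl// ler_pM2l// lerDl.
Unshelve. all: by end_near. Qed.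

HB.instance Definition _ := Uniform_isComplete.Build walg walg_complete.

Lemma wcoord_vabs x j : wcoord (vabs x) j = `|wcoord x j|.
Proof.
rewrite wcoord_join wcoordN.
by case: (ger0P (wcoord x j)) => h; [apply/max_idPl | apply/max_idPr]; lra.
Qed.

Lemma walg_lattice_norm x y : vabs x <=v vabs y -> `|x| <= `|y|.
Proof.
move=> /wvleP xy; apply: wnorm_mono => j.
by have := xy j; rewrite !wcoord_vabs.
Qed.
Lemma walg_normM x y : `|(x * y)%g| <= `|x| * `|y|.
Proof.
apply: le_trans (wnormM _ _ _); rewrite le_eqVlt; apply/orP; left; apply/eqP.
by apply: wnorm_eq => j; rewrite wcoordM.
Qed.

HB.instance Definition _ := FAlgebra_isBanachFAlgebra.Build R walg
  walg_lattice_norm walg_normM.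

Lemma walg_semiprime : semiprime walg.
Proof.
move=> x xx; apply: walgP => j; have /eqP := congr1 (wcoord^~ j) xx.
by rewrite /= wcoordM wcoord0 !mulf_eq0 gt_eqF ?weight_gt0//= orbb => /eqP.
Qed.

Lemma walg_finite_dimensional : finite_dimensional walg.
Proof.
exists #|J|, (fun i => wmk (fun j => (j == enum_val i)%:R)) => x.
exists (fun i => wcoord x (enum_val i)); apply: walgP => j.
have -> : wcoord x j =
    \sum_(i < #|J|) wcoord x (enum_val i) * (j == enum_val i)%:R.
  rewrite (bigD1 (enum_rank j))//= enum_rankK eqxx mulr1 big1 ?addr0// => i ij.
  case: eqP => [ji|]; last by rewrite mulr0.
  by move: ij; rewrite ji enum_valK eqxx.
elim/big_ind2: _ => [|a b c d -> ->|i _]; rewrite ?wcoord0 ?wcoordD//.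
by rewrite wcoordZ wcoord_mk.
Qed.

End WeightedAlgebra.

(** * Local approximation of elements by multiples of one of them *)
Section Cells.
Variables (R : realType) (n : nat) (F : banachFAlgType R) (x : 'I_n -> F).
Hypothesis x_le1 : forall i, `|x i| <= 1.
Implicit Types (f g u v : F) (r c d : R) (lam : 'I_n -> R).

Definition gens_sup : F := \big[@vjoin R F/0]_(i < n) vabs (x i).
Local Notation e := gens_sup.

Lemma gens_sup_ge0 : 0 <=v e.
Proof.
rewrite /gens_sup; elim/big_ind: _ => [|a b a0 _|i _]; first exact: vlexx.
  exact: vler_trans a0 (vjoinl _ _).
exact: vabs_ge0.
Qed.

Lemma vabs_le_gens_sup i : vabs (x i) <=v e.
Proof.
rewrite /gens_sup; have : i \in index_enum 'I_n by rewrite mem_index_enum.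
elim: (index_enum _) => // j s IH; rewrite inE big_cons => /orP[/eqP <-|/IH h].
  exact: vjoinl.
exact: vler_trans h (vjoinr _ _).
Qed.

(** Each generator acts as a contraction on [e] because its norm is at most 1,
    although the norm of [e] itself can be as large as [n]. *)
Lemma gens_sup_mul_le : (e * e)%g <=v e.
Proof.
have e0 := gens_sup_ge0.
rewrite {1}/gens_sup; elim/big_ind: _ => [|a b ae be|i _].
  by rewrite v0mul.
  exact: vjoin_mul_le.
apply: (vler_trans (vmull_le (vabs_ge0 _) e0)).
by rewrite vnorm_abs -[X in _ <=v X]scale1r; exact: vleZl.
Qed.

(** On the support of [u], the quotient [f / e] differs from [r] by at most
    [d]. *)
Definition vnear u d r f := vlemod u (vabs (f - r *: e)) (d *: e).

Lemma vnear_le u d d' r f :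
  0 <=v u -> d <= d' -> vnear u d r f -> vnear u d' r f.
Proof.
move=> u0 dd' h; apply: (vlemod_vle_trans u0 h).
by apply: vleZl => //; exact: gens_sup_ge0.
Qed.

Lemma vnearD u d d' r r' f f' : 0 <=v u ->
  vnear u d r f -> vnear u d' r' f' -> vnear u (d + d') (r + r') (f + f').
Proof.
move=> u0 h h'; rewrite /vnear !scalerDl.
apply: (@vle_vlemod_trans _ _ _ _
  (vabs (f - r *: e) + vabs (f' - r' *: e))) => //.
  by rewrite opprD addrACA; exact: vabsD_le.
exact: vlemodD.
Qed.

Lemma vnearZ u d r a f : 0 <=v u ->
  vnear u d r f -> vnear u (`|a| * d) (a * r) (a *: f).
Proof.
move=> u0 h; rewrite /vnear -!scalerA -scalerBr vabsZ.
exact: vlemodZ.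
Qed.

Lemma vnear_join u d d' r s f g : 0 <=v u ->
  vnear u d r f -> vnear u d' s g -> vnear u (d + d') (Num.max r s) (f `\/` g).
Proof.
move=> u0 h h'; rewrite /vnear.
have -> : Num.max r s *: e = (r *: e) `\/` (s *: e).
  have e0 := gens_sup_ge0.
  case: leP => rs; apply: vle_eq.
  - exact: vjoinr.
  - by apply: vjoin_le; [exact: vleZl | exact: vlexx].
  - exact: vjoinl.
  - by apply: vjoin_le; [exact: vlexx | apply: vleZl => //; exact: ltW].
rewrite scalerDl; apply: (vle_vlemod_trans u0 (vabs_join_le _ _ _ _)).
exact: vlemodD.
Qed.

Lemma vnear_abs u d r f : 0 <=v u -> vnear u d r f ->
  vlemod u (vabs f) ((d + `|r|) *: e).
Proof.
move=> u0 h; rewrite scalerDl.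
apply: (@vle_vlemod_trans _ _ _ _ (vabs (f - r *: e) + `|r| *: e)) => //.
  rewrite -[X in _ + X](_ : vabs (r *: e) = _); last first.
    by rewrite vabsZ vabs_ge0_id//; exact: gens_sup_ge0.
  by rewrite -{1}[f](subrK (r *: e)); exact: vabsD_le.
by apply: vlemodD => //; exact: vlemodxx.
Qed.

(** Write [f * g - c r s e] as the sum of [(f - r e) * g], [r e * (g - s e)] and
    [r s (e * e - c e)]; one factor [e] of each product is absorbed by
    [e * e <= e]. *)
Lemma vnearM u d d' d'' r s c f g : 0 <=v u -> 0 <= d -> 0 <= d' ->
  vnear u d r f -> vnear u d' s g -> vnear u d'' c (e * e)%g ->
  vnear u (d * (d' + `|s|) + `|r| * d' + `|r| * `|s| * d'')
    (c * r * s) (f * g)%g.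
Proof.
move=> u0 d0 d'0 hf hg hc; have e0 := gens_sup_ge0.
have split3 : (f * g)%g - (c * r * s) *: e =
    ((f - r *: e)%R * g)%g + ((r *: e)%R * (g - s *: e)%R)%g
    + (r * s) *: ((e * e)%g - c *: e).
  rewrite vla_mulDl vNmul vla_mulDr vmulN !vla_scaleAl vla_scaleAr.
  rewrite scalerBr !scalerA [r * s * c]mulrC mulrA.
  by rewrite !subrKA.
rewrite /vnear split3 !scalerDl.
apply: (vle_vlemod_trans u0 (vabsD_le _ _)); apply: vlemodD => //; last first.
  rewrite vabsZ -normrM -scalerA; exact: vlemodZ.
apply: (vle_vlemod_trans u0 (vabsD_le _ _)); apply: vlemodD => //.
  apply: (vle_vlemod_trans u0 (vabsM_le _ _)).
  apply: (@vlemod_trans _ _ _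
    (vabs (f - r *: e) * ((d' + `|s|) *: e)%R)%g) => //.
    by apply: vlemod_mull => //; [exact: vabs_ge0 | exact: vnear_abs].
  have h0 : 0 <= d' + `|s| by rewrite addr_ge0.
  rewrite vla_scaleAr mulrC -scalerA; apply: vlemodZ => //.
  apply: (@vlemod_trans _ _ _ ((d *: e)%R * e)%g) => //.
    exact: vlemod_mulr.
  rewrite vla_scaleAl; apply: vle_mod => //; apply: vleZ => //.
  exact: gens_sup_mul_le.
apply: (vle_vlemod_trans u0 (vabsM_le _ _)).
rewrite vabsZ vabs_ge0_id// vla_scaleAl -scalerA; apply: vlemodZ => //.
apply: (@vlemod_trans _ _ _ (e * (d' *: e)%R)%g) => //.
  exact: vlemod_mull.
rewrite vla_scaleAr; apply: vle_mod => //; apply: vleZ => //.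
exact: gens_sup_mul_le.
Qed.

(** The first and third conditions are one-sided and exact. They are what makes
    the norm on the grid at most 1 on the generators, and submultiplicative,
    without any loss. In the third, the positive weight [c] may exceed the
    actual value of [e * e] relative to [e], which can be [0]; the term [d] and
    the factor [1 + d] make up for this. *)
Definition cell d lam c u :=
  [/\ forall i, vlemod u (`|lam i| *: e) (vabs (x i)),
      forall i, vnear u d (lam i) (x i),
      vlemod u (((1 + d) * c) *: e) ((e * e)%g + d *: e)
    & vnear u d c (e * e)%g].

(** Homomorphisms to the line with product [c * a * b]; if [c > 0], then [c] times
    such a map is multiplicative in the usual sense. *)
Record weighted_char lam c (s : F -> R) : Prop := WeightedChar {
  charD : forall f g, s (f + g) = s f + s g ;
  charZ : forall a f, s (a *: f) = a * s f ;
  char_join : forall f g, s (f `\/` g) = Num.max (s f) (s g) ;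
  charM : forall f g, s (f * g)%g = c * s f * s g ;
  char_x : forall i, s (x i) = lam i ;
  char_le : forall f, `|s f| <= `|f|
}.

(** The tolerance [r] is reached on all sufficiently small cells, uniformly in
    the parameters of the cell: a finite grid can then serve them all. *)
Definition local_approx f := forall r, 0 < r -> exists2 d0, 0 < d0 &
  forall d lam c s u, 0 < d <= d0 -> 0 <=v u -> weighted_char lam c s ->
  cell d lam c u -> vnear u r (s f) f.

(** The cells only see what happens on the band of [e], so that [f] is also
    required to live there. *)
Definition approximable f := (exists C, vabs f <=v C *: e) /\ local_approx f.

Lemma approximable_x i : approximable (x i).
Proof.
split; first by exists 1; rewrite scale1r; exact: vabs_le_gens_sup.
move=> r r0; exists r => // d lam c s u /andP[_ dr] u0 cs [_ h _ _].
by rewrite (char_x cs); apply: vnear_le (h i).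
Qed.

Lemma approximable0 : approximable 0.
Proof.
split.
  exists 0; rewrite scale0r vabs_ge0_id; exact: vlexx.
move=> r r0; exists 1 => // d lam c s u _ u0 cs _.
have -> : s 0 = 0 by rewrite -[X in s X](scale0r 0) (charZ cs) mul0r.
rewrite /vnear scale0r subr0 vabs_ge0_id; last exact: vlexx.
by apply: vle_mod => //; apply: vscale_ge0; [exact: ltW | exact: gens_sup_ge0].
Qed.

Lemma approximable_bound f : approximable f ->
  exists2 C, 0 <= C & vabs f <=v C *: e.
Proof.
move=> [[C fC] _]; exists `|C| => //; apply: (vler_trans fC).
by apply: vleZl; [exact: gens_sup_ge0 | exact: ler_norm].
Qed.

Lemma local_approx2 f g r : 0 < r -> local_approx f -> local_approx g ->
  exists2 d0, 0 < d0 & forall d lam c s u, 0 < d <= d0 -> 0 <=v u ->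
  weighted_char lam c s -> cell d lam c u ->
  vnear u r (s f) f /\ vnear u r (s g) g.
Proof.
move=> r0 /(_ r r0)[d1 d10 h1] /(_ r r0)[d2 d20 h2].
exists (Num.min d1 d2); first by rewrite lt_min d10.
move=> d lam c s u /andP[d0]; rewrite le_min => /andP[dd1 dd2] u0 cs cu.
by split; [apply: (h1 d lam c) | apply: (h2 d lam c)]; rewrite ?d0.
Qed.

Lemma approximableD f g :
  approximable f -> approximable g -> approximable (f + g).
Proof.
move=> [[C fC] lf] [[C' gC] lg]; split.
  exists (C + C'); rewrite scalerDl; apply: (vler_trans (vabsD_le _ _)).
  exact: vleD.
move=> r r0; have r2 : 0 < r / 2 by rewrite divr_gt0.
have [d0 d00 h] := local_approx2 r2 lf lg.
exists d0 => // d lam c s u dd u0 cs cu; rewrite (charD cs) [r]splitr.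
by have [? ?] := h _ _ _ _ _ dd u0 cs cu; exact: vnearD.
Qed.

Lemma approximableZ a f : approximable f -> approximable (a *: f).
Proof.
move=> [[C fC] lf]; split.
  by exists (`|a| * C); rewrite vabsZ -scalerA; exact: vleZ.
move=> r r0; have a1 : 0 < `|a| + 1 by rewrite ltr_wpDl.
have [|d0 d00 h] := lf (r / (`|a| + 1)); first by rewrite divr_gt0.
exists d0 => // d lam c s u dd u0 cs cu; rewrite (charZ cs).
apply: (@vnear_le _ (`|a| * (r / (`|a| + 1)))) => //.
  by rewrite mulrCA ger_pMr// ler_pdivrMr// mul1r lerDl.
by apply: vnearZ => //; exact: h cu.
Qed.

Lemma approximable_join f g :
  approximable f -> approximable g -> approximable (f `\/` g).
Proof.
move=> Pf Pg; have [C C0 fC] := approximable_bound Pf.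
have [C' C'0 gC] := approximable_bound Pg.
case: Pf Pg => [_ lf] [_ lg]; split.
  exists (C + C'); rewrite scalerDl.
  apply: (@vler_trans _ _ (vabs f + vabs g)); last exact: vleD.
  have := vabs_join_le f g 0 0; rewrite !subr0.
  by rewrite (_ : 0 `\/` 0 = 0) ?subr0//; apply: vle_eq;
    [apply: vjoin_le; exact: vlexx | exact: vjoinl].
move=> r r0; have r2 : 0 < r / 2 by rewrite divr_gt0.
have [d0 d00 h] := local_approx2 r2 lf lg.
exists d0 => // d lam c s u dd u0 cs cu; rewrite (char_join cs) [r]splitr.
by have [? ?] := h _ _ _ _ _ dd u0 cs cu; exact: vnear_join.
Qed.

(** The constants come from [vnearM], where the values of the character at [f]
    and [g] are bounded by the norms of [f] and [g]. *)
Lemma approximableM f g :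
  approximable f -> approximable g -> approximable (f * g)%g.
Proof.
move=> Pf Pg; have [C C0 fC] := approximable_bound Pf.
have [C' C'0 gC] := approximable_bound Pg.
have e0 := gens_sup_ge0.
case: Pf Pg => [_ lf] [_ lg]; split.
  exists (C * C'); apply: (vler_trans (vabsM_le _ _)).
  apply: (@vler_trans _ _ ((C *: e)%R * (C' *: e)%R)%g).
    apply: (@vler_trans _ _ ((C *: e)%R * vabs g)%g).
      by apply: vmul_le2r => //; exact: vabs_ge0.
    by apply: vmul_le2l => //; exact: vscale_ge0.
  rewrite vla_scaleAl vla_scaleAr scalerA; apply: vleZ; first exact: mulr_ge0.
  exact: gens_sup_mul_le.
move=> r r0.
pose M := (1 + `|f|) * (1 + `|g|).
have M0 : 0 < M by rewrite mulr_gt0// ltr_pwDl.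
pose q := Num.min 1 (r / M).
have q0 : 0 < q by rewrite lt_min ltr01 divr_gt0.
have q1 : q <= 1 by rewrite ge_min lexx.
have qM : q * M <= r by rewrite -ler_pdivlMr// ge_min lexx orbT.
have [d0 d00 h] := local_approx2 q0 lf lg.
exists (Num.min d0 q); first by rewrite lt_min d00.
move=> d lam c s u /andP[dd]; rewrite le_min => /andP[dd0 dq] u0 cs cu.
have [|hf hg] := h _ _ _ _ _ _ u0 cs cu; first by rewrite dd.
rewrite (charM cs); case: cu => _ _ _ hc.
have q0' := ltW q0.
apply: vnear_le (vnearM u0 q0' q0' hf hg hc) => //.
apply: le_trans qM; rewrite /M.
have := char_le cs f; have := char_le cs g.
have := normr_ge0 (s f); have := normr_ge0 (s g).
move: `|s f| `|s g| `|f| `|g| => a b A B b0 a0 bB aA.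
have h1 : q * (q + b) <= q * (1 + B) by rewrite ler_wpM2l// lerD.
have h2 : a * q <= A * q by rewrite ler_wpM2r.
have h3 : a * b * d <= A * B * q.
  by rewrite ler_pM ?mulr_ge0// ?ler_pM// ltW.
nra.
Qed.

(** * The grid, its cells and its norm *)
Section Grid.
Variable K : nat.
Local Notation N := K.+1.

(** For each generator a sign and a level, and a level for [e * e]. *)
Definition grid : finType := ({ffun 'I_n -> bool * 'I_N} * 'I_N)%type.

Definition grid_val (j : grid) (i : 'I_n) : R :=
  (-1) ^+ (j.1 i).1 * ((j.1 i).2%:R / N%:R).

(** With [d = 1 / (K + 1)] and [k] the level of [e * e], this weight is
    [(k d + d) / (1 + d)], which lies in ]0, 1] even if [k = 0]. Then
    [e * e >= k d e] gives exactly the third condition of [cell]. *)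
Definition grid_weight (j : grid) : R := j.2.+1%:R / N.+1%:R.

Definition grid_cell (j : grid) u :=
  cell N%:R^-1 (grid_val j) (grid_weight j) u.

Lemma grid_weight_gt0 j : 0 < grid_weight j.
Proof. by rewrite divr_gt0 ?ltr0n. Qed.

Lemma grid_weight_le1 j : grid_weight j <= 1.
Proof. by rewrite ler_pdivrMr ?ltr0n// mul1r ler_nat ltnS ltnW. Qed.

Lemma norm_grid_val j i : `|grid_val j i| = (j.1 i).2%:R / N%:R.
Proof. by rewrite normrM normr_sign mul1r ger0_norm// divr_ge0. Qed.

Lemma grid_val_le1 j i : `|grid_val j i| <= 1.
Proof. by rewrite norm_grid_val ler_pdivrMr ?ltr0n// mul1r ler_nat ltnW. Qed.

(** Take the largest level that [a] still exceeds on a part of [u]; beyond it,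
    [a] is below the next level on all of [u]. *)
Lemma level_set u a d m : 0 <=v u -> u != 0 -> 0 <=v a ->
  vlemod u a ((m.+1%:R * d) *: e) ->
  exists k : 'I_m.+1, exists v, [/\ 0 <=v v, v <=v u, v != 0,
    vlemod v ((k%:R * d) *: e) a & vlemod v a ((k.+1%:R * d) *: e)].
Proof.
move=> u0 un0 a0; elim: m => [|m IH] ua.
  exists ord0, u; split => //; first exact: vlexx.
  by rewrite mul0r scale0r; exact: vle_mod.
have [h|h] := eqVneq (vpos (a - (m.+1%:R * d) *: e) `/\` u) 0.
  have [k [v [v0 vu vn0 h1 h2]]] := IH h.
  by exists (widen_ord (leqnSn _) k), v.
set v := _ `/\` u in h.
have v0 : 0 <=v v by apply: vmeet_ge => //; exact: vpos_ge0.
exists ord_max, v; split => //; first exact: vmeetr.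
  apply: (@vlemod_sub _ _ (vpos (a - (m.+1%:R * d) *: e))) => //.
    exact: vmeetl.
  exact: vlemod_pos.
by apply: (@vlemod_sub _ _ u) => //; exact: vmeetr.
Qed.

Lemma scale_level a : a <=v e -> a <=v (N%:R * N%:R^-1) *: e.
Proof. by rewrite mulfV ?scale1r// pnatr_eq0. Qed.

Definition good_coord u i (p : bool * 'I_N) :=
  let l := (-1) ^+ p.1 * (p.2%:R / N%:R) in
  vlemod u (`|l| *: e) (vabs (x i)) /\ vnear u N%:R^-1 l (x i).

Lemma good_coord_sub u v i p : 0 <=v v -> v <=v u ->
  good_coord u i p -> good_coord v i p.
Proof. by move=> v0 vu [h1 h2]; split; exact: vlemod_sub vu _. Qed.

(** First shrink [u] to make the sign of [x i] constant, then locate the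
    modulus of [x i] among the levels, which [vabs (x i) <= e] bounds. *)
Lemma good_coord_exists u i : 0 <=v u -> u != 0 ->
  exists p, exists v, [/\ 0 <=v v, v <=v u, v != 0 & good_coord v i p].
Proof.
move=> u0 un0.
have [b [w [w0 wu wn0 hw]]] : exists b : bool, exists w,
    [/\ 0 <=v w, w <=v u, w != 0 & vlemod w 0 ((-1) ^+ b *: x i)].
  have [h|h] := eqVneq (vpos (x i) `/\` u) 0.
    exists true, u; split => //; first exact: vlexx.
    by rewrite expr1 scaleN1r /vlemod sub0r opprK.
  exists false, (vpos (x i) `/\` u); split => //.
  - by apply: vmeet_ge => //; exact: vpos_ge0.
  - exact: vmeetr.
  rewrite expr0 scale1r; apply: (@vlemod_sub _ _ (vpos (x i))).
  - by apply: vmeet_ge => //; exact: vpos_ge0.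
  - exact: vmeetl.
  by have := vlemod_pos (x i) 0; rewrite subr0.
set y := (-1) ^+ b *: x i in hw.
have absy : vabs y = vabs (x i) by rewrite vabsZ normr_sign scale1r.
have [|k [v [v0 vw vn0 h1 h2]]] :=
  @level_set w (vabs (x i)) N%:R^-1 K w0 wn0 (vabs_ge0 _).
  by apply: vle_mod => //; apply/scale_level/vabs_le_gens_sup.
have vu := vler_trans vw wu.
exists (b, k), v; split => //; split => /=.
  by rewrite normrM normr_sign mul1r ger0_norm// divr_ge0.
have hy : vlemod v 0 y by exact: vlemod_sub vw hw.
have hy' : vlemod v (vabs (x i)) y.
  rewrite -absy; apply: vlemod_join => //; first exact: vlemodxx.
  by apply: (vlemod_trans v0 _ hy); have := vlemodN hy; rewrite oppr0.
have -> : vnear v N%:R^-1 ((-1) ^+ b * (k%:R / N%:R)) (x i) =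
    vlemod v (vabs (y - (k%:R / N%:R) *: e)) (N%:R^-1 *: e).
  have xy : x i = (-1) ^+ b *: y by rewrite scalerA -expr2 sqrr_sign scale1r.
  rewrite /vnear {1}xy -[_ *: e]scalerA.
  by rewrite -scalerBr vabsZ normr_sign scale1r.
apply: vlemod_join => //.
  have := vlemodD v0 h2 (vlemodxx (- ((k%:R / N%:R) *: e)) v0).
  rewrite -scalerBl -[k.+1%:R]natr1 mulrDl mul1r addrAC subrr add0r.
  apply: vle_vlemod_trans => //.
  by apply: vle_add2r; rewrite -absy; exact: vle_abs.
rewrite opprB.
have := vlemodD v0 (vlemod_trans v0 h1 hy') (vlemodxx (- y) v0).
rewrite subrr => h; apply: (vlemod_vle_trans v0 h).
by apply: vscale_ge0; [rewrite invr_ge0 | exact: gens_sup_ge0].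
Qed.

Lemma good_coords u : 0 <=v u -> u != 0 ->
  exists p : {ffun 'I_n -> bool * 'I_N}, exists v,
    [/\ 0 <=v v, v <=v u, v != 0 & forall i, good_coord v i (p i)].
Proof.
move=> u0 un0.
have [v [v0 vu vn0 h]] : exists v, [/\ 0 <=v v, v <=v u, v != 0 &
    forall i, i \in index_enum 'I_n -> exists p, good_coord v i p].
  elim: (index_enum _) => [|i s [v [v0 vu vn0 h]]].
    by exists u; split => //; exact: vlexx.
  have [p [w [w0 wv wn0 hp]]] := good_coord_exists i v0 vn0.
  exists w; split => //; first exact: vler_trans wv vu.
  move=> k; rewrite inE => /orP[/eqP ->|/h [q hq]]; first by exists p.
  by exists q; exact: good_coord_sub hq.
have [p hp] := choice (fun i => h i (mem_index_enum i)).
by exists [ffun i => p i], v; split => // i; rewrite ffunE.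
Qed.

(** Shrink [u] for one generator after another, and at last for [e * e]. *)
Lemma grid_cell_cover u : 0 <=v u -> u != 0 ->
  exists j : grid, exists v, [/\ 0 <=v v, v <=v u, v != 0 & grid_cell j v].
Proof.
move=> u0 un0; have e0 := gens_sup_ge0.
have [p [w [w0 wu wn0 hp]]] := good_coords u0 un0.
have [|k [v [v0 vw vn0 h1 h2]]] :=
  @level_set w (e * e)%g N%:R^-1 K w0 wn0 (vla_mul_ge0 _ _ e0 e0).
  by apply: vle_mod => //; apply/scale_level/gens_sup_mul_le.
exists (p, k), v; split => //; first exact: vler_trans vw wu.
have N0 : (0 : R) < N%:R by rewrite ltr0n.
have N1 : (N.+1%:R : R) = N%:R + 1 by rewrite natr1.
have k1 : (k.+1%:R : R) = k%:R + 1 by rewrite natr1.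
have k0 : (0 : R) <= k%:R by [].
have kN : (k%:R : R) <= N%:R by rewrite ler_nat ltnW.
split => [i|i||].
- by have [h _] := good_coord_sub v0 vw (hp i).
- by have [_ h] := good_coord_sub v0 vw (hp i).
- have -> : (1 + N%:R^-1) * grid_weight (p, k) = k%:R * N%:R^-1 + N%:R^-1.
    by rewrite /grid_weight /= N1 k1; field; rewrite !gt_eqF//= addr_gt0.
  rewrite scalerDl; apply: vlemodD => //; exact: vlemodxx.
have lo : grid_weight (p, k) - N%:R^-1 <= k%:R * N%:R^-1.
  rewrite lerBlDr -[X in _ + X]mul1r -mulrDl -k1 /grid_weight /= N1.
  by rewrite ler_wpM2l// lef_pV2 ?posrE ?addr_gt0// lerDl.
have hi : k.+1%:R * N%:R^-1 <= grid_weight (p, k) + N%:R^-1.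
  rewrite k1 mulrDl mul1r lerD2r /grid_weight /= N1 k1.
  rewrite ler_pdivrMr// mulrAC ler_pdivlMr ?addr_gt0//.
  by rewrite mulrDr mulrDl mulr1 mul1r lerD2l.
apply: vlemod_join => //.
  have := vlemodD v0 h2 (vlemodxx (- (grid_weight (p, k) *: e)) v0).
  rewrite -scalerBl => h; apply: (vlemod_vle_trans v0 h); apply: vleZl => //.
  by rewrite lerBlDl.
rewrite opprB.
pose w1 := grid_weight (p, k) *: e - k%:R * N%:R^-1 *: e - (e * e)%g.
have := vlemodD v0 h1 (vlemodxx w1 v0); rewrite /w1.
rewrite addrA [_ + (_ - k%:R * _ *: _)]addrC subrK => h.
apply: (vlemod_vle_trans v0 h).
rewrite addrCA subrr addr0 -scalerBl; apply: vleZl => //.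
by rewrite lerBlDl -lerBlDr.
Qed.


Definition dominates (t : grid -> R) g :=
  0 <=v g /\ forall j u, 0 <=v u -> grid_cell j u -> vlemod u (`|t j| *: e) g.

Definition sup_norm (t : grid -> R) : R := \big[Num.max/0]_j `|t j|.

(** [e] lies above every coordinate bound, so the set is not empty
    ([dominates_sup]). *)
Definition dom_norm (t : grid -> R) : R :=
  inf [set `|g| | g in dominates t]%classic.

(** [dom_norm] alone ignores the coordinates of empty cells, hence need not be
    definite. The supremum repairs this, and it is harmless: it is itself a
    submultiplicative lattice norm, as the weights are at most 1. It also bounds
    the error term in the proof of [grid_normM]. *)
Definition grid_norm (t : grid -> R) : R := Num.max (sup_norm t) (dom_norm t).

Lemma sup_norm_ge t j : `|t j| <= sup_norm t.
Proof. exact: (le_bigmax _ (fun j => `|t j|)). Qed.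

Lemma sup_norm_le t r : 0 <= r -> (forall j, `|t j| <= r) -> sup_norm t <= r.
Proof. by move=> r0 tr; apply: bigmax_le => // j _. Qed.

Lemma sup_norm_ge0 t : 0 <= sup_norm t.
Proof. exact: bigmax_ge_id. Qed.

Lemma dominates_sup t : dominates t (sup_norm t *: e).
Proof.
split; first by apply: vscale_ge0; [exact: sup_norm_ge0 | exact: gens_sup_ge0].
move=> j u u0 _; apply: vle_mod => //; apply: vleZl; first exact: gens_sup_ge0.
exact: sup_norm_ge.
Qed.

Lemma dom_norm_lb t : lbound [set `|g| | g in dominates t]%classic 0.
Proof. by move=> _ [g _ <-]. Qed.

Lemma dom_norm_le t g : dominates t g -> dom_norm t <= `|g|.
Proof.
by move=> tg; apply: ge_inf; [exists 0; exact: dom_norm_lb | exists g].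
Qed.

Lemma dom_norm_lt t r :
  0 < r -> exists2 g, dominates t g & `|g| < dom_norm t + r.
Proof.
move=> r0; have hi : has_inf [set `|g| | g in dominates t]%classic.
  split; last by exists 0; exact: dom_norm_lb.
  exists `|sup_norm t *: e|; exists (sup_norm t *: e) => //.
  exact: dominates_sup.
by have [_ [g tg <-] gr] := inf_adherent r0 hi; exists g.
Qed.

Lemma grid_norm_lt t r :
  0 < r -> exists2 g, dominates t g & `|g| < grid_norm t + r.
Proof.
move=> /(dom_norm_lt t)[g tg gr]; exists g => //; apply: (lt_le_trans gr).
by rewrite lerD2r le_max lexx orbT.
Qed.

Lemma sup_grid_norm t : sup_norm t <= grid_norm t.
Proof. by rewrite le_max lexx. Qed.

Lemma grid_norm_ge t j : `|t j| <= grid_norm t.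
Proof. exact: le_trans (sup_norm_ge t j) (sup_grid_norm t). Qed.

Lemma grid_norm_ge0 t : 0 <= grid_norm t.
Proof. exact: le_trans (sup_norm_ge0 t) (sup_grid_norm t). Qed.

Lemma grid_norm_le t r : 0 <= r -> (forall j, `|t j| <= r) ->
  (forall d, 0 < d -> exists2 g, dominates t g & `|g| <= r + d) ->
  grid_norm t <= r.
Proof.
move=> r0 tr h; rewrite ge_max sup_norm_le//=; apply/ler_addgt0Pr => d /h[g tg].
exact/le_trans/dom_norm_le.
Qed.

Lemma dominates_le t s g : (forall j, `|t j| <= `|s j|) ->
  dominates s g -> dominates t g.
Proof.
move=> ts [g0 sg]; split=> // j u u0 ju.
apply: (vle_vlemod_trans u0 _ (sg j u u0 ju)).
by apply: vleZl => //; exact: gens_sup_ge0.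
Qed.

Lemma grid_norm_mono t s : (forall j, `|t j| <= `|s j|) ->
  grid_norm t <= grid_norm s.
Proof.
move=> ts; apply: grid_norm_le; first exact: grid_norm_ge0.
  by move=> j; apply: (le_trans (ts j)); exact: grid_norm_ge.
move=> d /(grid_norm_lt s)[g sg /ltW gd]; exists g => //.
exact: dominates_le sg.
Qed.

Lemma grid_normD t s :
  grid_norm (fun j => t j + s j) <= grid_norm t + grid_norm s.
Proof.
apply: grid_norm_le; first by rewrite addr_ge0 ?grid_norm_ge0.
  by move=> j; apply: (le_trans (ler_normD _ _)); rewrite lerD ?grid_norm_ge.
move=> d d0; have d2 : 0 < d / 2 by rewrite divr_gt0.
have [g [g0 tg] gd] := grid_norm_lt t d2.
have [h [h0 sh] hd] := grid_norm_lt s d2.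
exists (g + h); last by apply: (le_trans (ler_normD _ _)); lra.
split; first exact: vaddr_ge0.
move=> j u u0 ju.
apply: (@vle_vlemod_trans _ _ _ _ (`|t j| *: e + `|s j| *: e)) => //.
  by rewrite -scalerDl; apply: vleZl; [exact: gens_sup_ge0 | exact: ler_normD].
by apply: vlemodD => //; [exact: tg | exact: sh].
Qed.

Lemma grid_normZ a t : grid_norm (fun j => a * t j) = `|a| * grid_norm t.
Proof.
have le_aux b s : grid_norm (fun j => b * s j) <= `|b| * grid_norm s.
  apply: grid_norm_le; first by rewrite mulr_ge0 ?grid_norm_ge0.
    by move=> j; rewrite normrM ler_wpM2l ?grid_norm_ge.
  move=> d d0; have b1 : 0 < `|b| + 1 by rewrite ltr_wpDl.
  have [|g [g0 sg] gd] := @grid_norm_lt s (d / (`|b| + 1)).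
    by rewrite divr_gt0.
  exists (`|b| *: g).
    split; first exact: vscale_ge0.
    move=> j u u0 ju; rewrite normrM -scalerA; apply: vlemodZ => //; exact: sg.
  rewrite normrZ normr_id.
  apply: (@le_trans _ _ (`|b| * (grid_norm s + d / (`|b| + 1)))).
    by rewrite ler_wpM2l// ltW.
  rewrite mulrDr lerD2l mulrCA ger_pMr// ler_pdivrMr// mul1r.
  by rewrite lerDl.
apply: le_anti; rewrite le_aux/=.
have [->|an0] := eqVneq a 0; first by rewrite normr0 mul0r grid_norm_ge0.
have a0 : 0 < `|a| by rewrite normr_gt0.
rewrite mulrC -ler_pdivlMr// mulrC -normfV.
apply: le_trans (le_aux _ _); apply: grid_norm_mono => j.
by rewrite mulrA mulVf// mul1r.
Qed.

(** If [g] and [h] dominate [t] and [s], then on the cell of [j] one has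
    [(1 + d) w_j |t_j s_j| e <= |t_j s_j| (e * e + d e)
    <= g * h + d (sup |t|) h], so that [(g * h + d (sup |t|) h) / (1 + d)]
    dominates the product. Its norm is at most about [|t| |s|]. *)
Lemma grid_normM t s :
  grid_norm (fun j => grid_weight j * t j * s j) <= grid_norm t * grid_norm s.
Proof.
have e0 := gens_sup_ge0.
have t0 := grid_norm_ge0 t; have s0 := grid_norm_ge0 s.
apply: grid_norm_le; first exact: mulr_ge0.
  move=> j; rewrite 2!normrM (ger0_norm (ltW (grid_weight_gt0 j))).
  rewrite ler_pM ?grid_norm_ge//.
    by rewrite mulr_ge0// ltW ?grid_weight_gt0.
  rewrite -[leRHS]mul1r ler_pM ?grid_norm_ge ?grid_weight_le1//.
  by rewrite ltW ?grid_weight_gt0.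
move=> d d0; set a := grid_norm t in t0 *; set b := grid_norm s in s0 *.
(* [(a + q) * (b + q) <= a * b + q * (a + b + 1)] as soon as [q <= 1]. *)
pose q := Num.min 1 (d / (a + b + 1)).
have ab1 : 0 < a + b + 1 by rewrite ltr_wpDl// addr_ge0.
have q0 : 0 < q by rewrite lt_min ltr01 divr_gt0.
have q1 : q <= 1 by rewrite ge_min lexx.
have qd : q * (a + b + 1) <= d by rewrite -ler_pdivlMr// ge_min lexx orbT.
have [g [g0 tg] /ltW gq] := grid_norm_lt t q0.
have [h [h0 sh] /ltW hq] := grid_norm_lt s q0.
rewrite -/a in gq; rewrite -/b in hq.
(* [dl] is the size of the cells; dividing by [1 + dl] below undoes the factor
   in the third condition of [cell]. *)
pose dl : R := N%:R^-1; have dl0 : 0 <= dl by rewrite invr_ge0.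
have dl1 : 0 < 1 + dl by rewrite ltr_pwDl.
exists ((1 + dl)^-1 *: ((g * h)%g + (dl * sup_norm t) *: h)).
  have st0 := sup_norm_ge0 t.
  split.
    apply: vscale_ge0; first by rewrite invr_ge0 ltW.
    apply: vaddr_ge0; first exact: vla_mul_ge0.
    by apply: vscale_ge0 => //; exact: mulr_ge0.
  move=> j u u0 ju; have := tg j u u0 ju; have := sh j u u0 ju => hs ht.
  have [_ _ hw _] := ju.
  have -> : `|grid_weight j * t j * s j| *: e =
      (1 + dl)^-1 *: ((`|t j| * `|s j|) *: (((1 + dl) * grid_weight j) *: e)).
    rewrite !scalerA 2!normrM (ger0_norm (ltW (grid_weight_gt0 j))).
    congr (_ *: _).
    by field; rewrite gt_eqF.
  apply: vlemodZ => //; first by rewrite invr_ge0 ltW.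
  apply: (@vlemod_trans _ _ _
    ((`|t j| * `|s j|) *: ((e * e)%g + dl *: e))) => //.
    by apply: vlemodZ => //; exact: mulr_ge0.
  rewrite scalerDr; apply: vlemodD => //.
    have -> : (`|t j| * `|s j|) *: (e * e)%g =
        ((`|t j| *: e)%R * (`|s j| *: e)%R)%g.
      by rewrite vla_scaleAl vla_scaleAr scalerA.
    apply: (@vlemod_trans _ _ _ (g * (`|s j| *: e)%R)%g) => //.
      by apply: vlemod_mulr => //; exact: vscale_ge0.
    exact: vlemod_mull.
  apply: (@vle_vlemod_trans _ _ _ _ ((dl * sup_norm t) *: (`|s j| *: e))) => //.
    rewrite !scalerA; apply: vleZl => //.
    by rewrite mulrC mulrA ler_wpM2r// ler_wpM2l// sup_norm_ge.
  by apply: vlemodZ => //; exact: mulr_ge0.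
rewrite normrZ ger0_norm ?invr_ge0; last exact: ltW.
rewrite ler_pdivrMl//; apply: (le_trans (ler_normD _ _)).
have st : sup_norm t <= a := sup_grid_norm t.
have st0 := sup_norm_ge0 t.
rewrite normrZ ger0_norm ?mulr_ge0//.
have h1 : `|(g * h)%g| <= (a + q) * (b + q).
  by apply: (le_trans (bfalg_normM _ _)); rewrite ler_pM.
have h2 : dl * sup_norm t * `|h| <= dl * ((a + q) * (b + q)).
  rewrite -mulrA ler_wpM2l// ler_pM//.
  by apply: (le_trans st); rewrite lerDl ltW.
have h3 : (a + q) * (b + q) <= a * b + d by nra.
apply: (@le_trans _ _ ((1 + dl) * ((a + q) * (b + q)))).
  by rewrite mulrDl mul1r lerD.
by rewrite ler_wpM2l// ltW.
Qed.

Definition grid_weightedNorm : weightedNorm R grid :=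
  WeightedNorm grid_weight_gt0 grid_normD grid_normZ grid_norm_mono
    grid_norm_ge grid_normM.

(** The modulus of [x i] dominates by the very definition of the cells. *)
Lemma grid_norm_coord i : grid_norm (fun j => grid_val j i) <= 1.
Proof.
apply: grid_norm_le => // [j|d d0]; first exact: grid_val_le1.
exists (vabs (x i)); last by rewrite vnorm_abs (le_trans (x_le1 i))// lerDl ltW.
by split; [exact: vabs_ge0 | move=> j u u0 [h _ _ _]; exact: h].
Qed.

(** Otherwise some part [v] of the support of
    [vpos (vabs f - (g + 2 r e))] lies in a cell. On it
    [g + 2 r e <= vabs f <= r e + g], which makes [e] disjoint from [v],
    although [v] is below a multiple of [e]. *)
Lemma dominates_bound f r (t : grid -> R) g : approximable f -> 0 < r ->
  (forall j u, 0 <=v u -> grid_cell j u -> vnear u r (t j) f) ->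
  dominates t g -> vabs f <=v g + (2 * r) *: e.
Proof.
move=> Pf r0 tf [g0 tg]; have e0 := gens_sup_ge0.
have [C C0 fC] := approximable_bound Pf.
set u := vpos (vabs f - (g + (2 * r) *: e)).
suff : u == 0 by rewrite vpos_eq0 vle_subl add0r.
apply/negPn/negP => un0; have u0 : 0 <=v u := vpos_ge0 _.
have [j [v [v0 vu vn0 jv]]] := grid_cell_cover u0 un0.
have h1 : vlemod v (g + (2 * r) *: e) (vabs f).
  by apply: (vlemod_sub v0 vu); exact: vlemod_pos.
have h2 : vlemod v (vabs f) (r *: e + g).
  apply: (vlemod_trans v0 (vnear_abs v0 (tf j v v0 jv))).
  rewrite scalerDl; apply: vlemodD => //; last exact: tg.
  exact: vlemodxx.
have h3 : vlemod v (r *: e) 0.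
  have := vlemod_trans v0 h1 h2.
  rewrite /vlemod subr0 (_ : g + _ - _ = r *: e)//.
  rewrite [r *: e + g]addrC opprD addrACA subrr add0r.
  by rewrite mulr_natl mulr2n scalerDl addrK.
rewrite /vlemod subr0 in h3.
have re0 : 0 <=v r *: e by apply: vscale_ge0 => //; exact: ltW.
have h4 : (r *: e) `/\` v = 0.
  by apply: (vmeet0_le re0 v0 (vle_vpos _) h3).
have h5 : (C *: e) `/\` v = 0.
  have := @vdisjZ _ _ (C / r) _ _ _ re0 v0 h4.
  by rewrite scalerA divfK ?gt_eqF//; apply; rewrite divr_ge0// ltW.
move: vn0; rewrite -(vmeet_idl (x := v) (y := C *: e)); last first.
  apply: (vler_trans vu); apply: vpos_le; last exact: vscale_ge0.
  rewrite vle_subl; apply: (vler_trans fC); apply: vlerDl.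
  by apply: vaddr_ge0 => //; apply: vscale_ge0 => //; rewrite mulr_ge0// ltW.
by rewrite vmeetC h5 eqxx.
Qed.

End Grid.
End Cells.

(** * The free Banach f-algebra over ell1 *)
Section FreeOverEll1.
Variables (R : realType) (n : nat) (F : banachFAlgType R).
Variable eta : {linear ell1 R n -> F}.
Hypothesis hF : is_FBfA eta.

Definition ell1_basis (i : 'I_n) : ell1 R n := delta_mx 0 i : 'rV[R]_n.

Lemma ell1_basis_norm i : `|ell1_basis i| = 1.
Proof.
rewrite -[LHS]/(ell1_norm _) /ell1_norm (bigD1 i)//= big1 ?addr0.
  by rewrite mxE !eqxx normr1.
by move=> k ki; rewrite mxE (negbTE ki) andbF normr0.
Qed.

Lemma ell1_sum (v : ell1 R n) : v = \sum_(i < n) v ord0 i *: ell1_basis i.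
Proof. exact: (row_sum_delta (v : 'rV[R]_n)). Qed.

Definition gen (i : 'I_n) : F := eta (ell1_basis i).

Lemma gen_le1 i : `|gen i| <= 1.
Proof. by rewrite hF.1 ell1_basis_norm. Qed.

Local Notation e := (gens_sup gen).

Section GridHom.
Variable K : nat.
Local Notation W := (walg (grid_weightedNorm gen K)).

Definition grid_gen (i : 'I_n) : W := wmk _ (fun j => grid_val R j i).

Definition grid_map0 (v : ell1 R n) : W := \sum_(i < n) v ord0 i *: grid_gen i.

Lemma grid_map0_linear : linear grid_map0.
Proof.
move=> a v w; rewrite /grid_map0 scaler_sumr -big_split /=.
apply: eq_bigr => i _.
by rewrite !mxE scalerDl scalerA.
Qed.

Definition grid_map : {linear ell1 R n -> W} :=
  HB.pack grid_map0
    (GRing.isLinear.Build R (ell1 R n) W _ grid_map0 grid_map0_linear).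

Lemma grid_gen_norm i : `|grid_gen i| <= 1.
Proof.
apply: le_trans (grid_norm_coord gen_le1 K i).
rewrite le_eqVlt; apply/orP; left; apply/eqP.
by apply: (@wnorm_eq _ _ (grid_weightedNorm gen K)) => j; rewrite wcoord_mk.
Qed.

Lemma grid_map_contractive : contractive grid_map.
Proof.
apply: opnorm_le1 => v; rewrite -[grid_map v]/(grid_map0 v).
apply: (le_trans (ler_norm_sum _ _ _)).
apply: ler_sum => i _; rewrite normrZ -[leRHS]mulr1 ler_wpM2l//.
exact: grid_gen_norm.
Qed.

(** The coordinates of the homomorphism to the grid algebra provide the
    weighted characters at all the parameters of the grid. *)
Lemma grid_hom : exists2 S : {linear F -> W}, is_extension eta grid_map S &
  forall j, weighted_char gen (grid_val R j) (grid_weight R j)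
    (fun f => wcoord (S f) j).
Proof.
have [S [[[Sj Sm SM] Seta] nS _]] := hF.2 _ _ grid_map_contractive.
exists S => // j; split => [f g|a f|f g|f g|i|f].
- by rewrite linearD wcoordD.
- by rewrite linearZ wcoordZ.
- by rewrite Sj wcoord_join.
- by rewrite SM wcoordM.
- rewrite /gen Seta /= /grid_map0 (bigD1 i)//= big1 ?addr0.
    by rewrite mxE !eqxx scale1r wcoord_mk.
  by move=> k ki; rewrite mxE (negbTE ki) andbF scale0r.
- apply: (le_trans (walg_coord_le _ _)); apply: opnorm_le.
  by rewrite nS; exact: grid_map_contractive.
Qed.

End GridHom.

Lemma grid_fine (d0 : R) : 0 < d0 -> exists K : nat, 0 < (K.+1%:R : R)^-1 <= d0.
Proof.
move=> d00; exists (Num.truncn (d0^-1)).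
rewrite invr_gt0 ltr0n/= -[leRHS]invrK lef_pV2 ?posrE ?invr_gt0 ?ltr0n//.
by apply/ltW/truncnS_gt.
Qed.

Lemma approximable_dominated f r : approximable gen f -> 0 < r ->
  exists K, forall S : {linear F -> walg (grid_weightedNorm gen K)},
  (forall j, weighted_char gen (grid_val R j) (grid_weight R j)
    (fun f => wcoord (S f) j)) ->
  forall g, dominates gen (wcoord (S f)) g -> vabs f <=v g + (2 * r) *: e.
Proof.
move=> Pf r0; have [d0 d00 h] := Pf.2 r r0; have [K dK] := grid_fine d00.
exists K => S cS g Sg; apply: dominates_bound (Sg) => // [|j u u0 ju].
  exact: gen_le1.
exact: (h _ _ _ _ _ dK u0 (cS j)).
Qed.

(** Norm convergence thus implies uniform convergence relative to [e]. The
    values of [f] on the grid are at most the norm of [f], so that the multiple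
    of [e] by this norm dominates. *)
Lemma approximable_le f : approximable gen f -> vabs f <=v `|f| *: e.
Proof.
move=> Pf; apply: (@vle_archi _ _ _ _ e) => r r0.
have r2 : 0 < r / 2 by rewrite divr_gt0.
have [K h] := approximable_dominated Pf r2.
have [S _ cS] := grid_hom K.
have := h S cS (`|f| *: e); rewrite [2 * _]mulrC divfK//; apply.
split; first by apply: vscale_ge0 => //; exact: gens_sup_ge0.
move=> j u u0 _; apply: vle_mod => //; apply: vleZl; first exact: gens_sup_ge0.
exact: (char_le (cS j)).
Qed.

Lemma approximableB f g :
  approximable gen f -> approximable gen g -> approximable gen (f - g).
Proof.
move=> Pf Pg; rewrite -scaleN1r; apply: approximableD => //.
exact: approximableZ.
Qed.

(** An approximation [g] of [f] in norm is an approximation relative to [e]: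
    compare [g] with a better approximation [h] of [f] through
    [approximable_le]. The three thirds of the tolerance are then spent on
    [f - g], on [g] and on the change of the character. *)
Lemma approximable_closed f :
  (forall r, 0 < r -> exists2 g, approximable gen g & `|f - g| <= r) ->
  approximable gen f.
Proof.
move=> lim_f; have e0 := gens_sup_ge0 gen.
have close r g : approximable gen g -> `|f - g| <= r -> vabs (f - g) <=v r *: e.
  move=> Pg fgr; apply: vle_eps => d d0.
  have e1 : 0 < `|e| + 1 by rewrite ltr_wpDl.
  pose q := d / (`|e| + 1); have q0 : 0 < q by rewrite divr_gt0.
  have [h Ph fhq] := lim_f q q0.
  exists (q *: e + vabs (f - h)).
    apply: (le_trans (ler_normD _ _)).
    rewrite normrZ vnorm_abs ger0_norm ?(ltW q0)//.
    have -> : d = q * `|e| + q.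
      by rewrite -[X in _ + X]mulr1 -mulrDr divfK ?gt_eqF.
    by rewrite lerD2l.
  have -> : f - g = (h - g) + (f - h) by rewrite [RHS]addrC subrKA.
  apply: (vler_trans (vabsD_le _ _)); rewrite addrA.
  apply: vleD; last exact: vlexx.
  apply: (vler_trans (approximable_le (approximableB Ph Pg))).
  rewrite -scalerDl; apply: vleZl => //.
  rewrite -[h - g](subrKA f) addrC; apply: (le_trans (ler_normD _ _)).
  by apply: lerD => //; rewrite distrC.
split.
  have [g Pg fg] := lim_f 1 ltr01; have [C C0 gC] := approximable_bound Pg.
  exists (1 + C); rewrite scalerDl -[f](subrK g).
  apply: (vler_trans (vabsD_le _ _)); apply: vleD => //.
  exact: close.
move=> r r0; have r3 : 0 < r / 3 by rewrite divr_gt0.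
have [g Pg fg] := lim_f _ r3.
have [d0 d00 h] := Pg.2 _ r3.
exists d0 => // d lam c s u dd u0 cs cu; have hg := h _ _ _ _ _ dd u0 cs cu.
have sfg : `|s f - s g| <= r / 3.
  apply: le_trans fg; have := char_le cs (f - g).
  by rewrite (charD cs) -[- g]scaleN1r (charZ cs) mulN1r scaleN1r.
have hfg : vnear gen u (r / 3) 0 (f - g).
  by rewrite /vnear scale0r subr0; apply: vle_mod => //; exact: close.
have hs : vnear gen u (r / 3) (s f - s g) 0.
  rewrite /vnear sub0r vabsN vabsZ (vabs_ge0_id e0).
  by apply: vle_mod => //; exact: vleZl.
have := vnearD u0 hs (vnearD u0 hfg hg).
rewrite add0r subrK add0r subrK; apply: vnear_le => //.
by rewrite le_eqVlt; apply/orP; left; apply/eqP; field.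
Qed.

Definition approximable_sub : closedSub F :=
  ClosedSub (@approximableD _ _ _ gen) (fun r => @approximableZ _ _ _ gen r)
    (@approximable_join _ _ _ gen) (@approximableM _ _ _ _ gen_le1)
    (approximable0 gen) approximable_closed.

Lemma all_approximable f : approximable gen f.
Proof.
apply: (FBfA_generated (P := approximable_sub) hF) => v.
rewrite (ell1_sum v) linear_sum /=.
elim/big_ind: _ => [|a b|i _]; first exact: approximable0.
  exact: approximableD.
by rewrite linearZ; apply/approximableZ/approximable_x.
Qed.

Lemma norm_le_tau f : `|f| <= tau eta f.
Proof.
have [[_ tauf] _] := tau_least f hF.
apply/ler_addgt0Pr => d d0.
have M0 : 0 < 1 + 2 * `|e| by rewrite ltr_pwDl// mulr_ge0.
pose r := d / (1 + 2 * `|e|); have r0 : 0 < r by rewrite divr_gt0.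
have dE : d = r + 2 * r * `|e|.
  have -> : d = r * (1 + 2 * `|e|) by rewrite divfK ?gt_eqF.
  by ring.
have [K h] := approximable_dominated (all_approximable f) r0.
have [S eS cS] := grid_hom K.
have := tauf _ (@walg_semiprime _ _ (grid_weightedNorm gen K))
  (@walg_finite_dimensional _ _ (grid_weightedNorm gen K)) _
  (grid_map_contractive K) S eS.
rewrite -[`|S f|]/(grid_norm gen (wcoord (S f))) => St.
have [g Sg gr] := grid_norm_lt gen (wcoord (S f)) r0.
have := vnorm_abs_le (h S cS g Sg) => /le_trans; apply.
apply: (le_trans (ler_normD _ _)); rewrite normrZ ger0_norm; last first.
  by rewrite mulr_ge0// ltW.
by rewrite dE addrA lerD2r; apply: (le_trans (ltW gr)); rewrite lerD2r.
Qed.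

End FreeOverEll1.

Lemma tau_le_norm (R : realType) (E : completeNormedModType R)
    (F : banachFAlgType R) (eta : {linear E -> F}) (f : F) :
  is_FBfA eta -> tau eta f <= `|f|.
Proof.
move=> hF; have [_] := tau_least f hF; apply; split=> // A _ _ T cT S eS.
have [S0 [_ nS0 uS0]] := hF.2 A T cT.
by rewrite (uS0 _ eS); apply: opnorm_le; rewrite nS0.
Qed.

Theorem theorem4p29 (R : realType) (n : nat) (F : banachFAlgType R)
    (eta : {linear ell1 R n -> F}) (hF : is_FBfA eta) (f : F) :
  `|f| = tau eta f.
Proof.
by apply: le_anti; rewrite (norm_le_tau hF) (tau_le_norm f hF).
Qed.
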